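(* Let $G$ be a finitely generated group acting tightly and acylindrically on a Bowditch graph $\mathcal G$. Then every loxodromic element of $G$ is Morse. In particular, if $G$ has loxodromic elements then every asymptotic cone of $G$ has cut-points.
   Context: Bowditch graph. Let $\mathcal G$ be a $\delta$-hyperbolic graph. For any two vertices $a,b$ a non-empty set of geodesics connecting $a,b$ is chosen; these geodesics are called tight. For $r\ge0$, $T(a,b;r)$ denotes the union of all the points (vertices) on all tight geodesics connecting a point in the ball $B(a,r)$ with a point in $B(b,r)$. $\mathcal G$, with its collection of tight geodesics, is a Bowditch graph if: (F0) every subpath of a tight geodesic is tight; (F1) for every $r>0$ there exist $m=m(r)$ and $k=k(r)$ such that for every three vertices $a,b,c$ with $\mathrm{dist}(c,\{a,b\})\ge k$, the set $F_c(a,b;r)=B(c,r)\cap T(a,b;r)$ contains at most $m$ points. Shadowing. Suppose $G=\langle S\rangle$ ($S$ finite) acts on $\mathcal G$ and the vertex set is $V(\mathcal G)=G\cdot\Delta$ for some finite set of vertices $\Delta$. For $g,h\in G$ and $o\in\mathcal G$, a geodesic in $\mathcal G$ with endpoints $g\cdot o$ and $h\cdot o$ $\Delta$-shadows a path with vertices $p_1=g,p_2,\dots,p_m=h$ in the Cayley graph $\mathrm{Cay}(G,S)$ if the sets $p_i\cdot\Delta$, $i=1,\dots,m$, cover the set of vertices of the geodesic. Tight action. $G$ acts tightly on $\mathcal G$ if: (T1) $G$ stabilizes the set of tight geodesics in $\mathcal G$; (T2) for every vertex $o$ of $\mathcal G$ there exist a finite set of vertices $\Delta$ in $\mathcal G$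 (with $V(\mathcal G)=G\cdot\Delta$) and numbers $\lambda\ge1,\kappa\ge0$ such that every $g,h\in G$ can be joined by a $(\lambda,\kappa)$-quasi-geodesic in $\mathrm{Cay}(G,S)$ that is $\Delta$-shadowed by a tight geodesic connecting $g\cdot o$ and $h\cdot o$. The action is acylindrical if there exist $l$ and $N$ such that for any pair of vertices $x,y$ with $\mathrm{dist}(x,y)\ge l$ there are at most $N$ distinct elements $g\in G$ with $gx=x$, $gy=y$. An element $g\in G$ is loxodromic if its translation length $\lim_{n\to\infty}\mathrm{dist}(x,g^nx)/n$ is $>0$. A bi-infinite quasi-geodesic $\mathfrak q$ is Morse if for every $L\ge1,C\ge0$ there is $M=M(L,C)$ such that every $(L,C)$-quasi-geodesic with endpoints on $\mathfrak q$ is contained in the $M$-neighborhood of $\mathfrak q$. An element $g$ of a finitely generated group $G$ is Morse if $(g^n)_{n\in\mathbb Z}$ is a Morse quasi-geodesic in a Cayley graph of $G$. Asymptotic cones of $G$ are ultralimits $\mathrm{Con}^\omega(\cdot,(o_n),(d_n))$ of the Cayley graph with basepoints $o_n$ and metric rescaled by $1/d_n$, for non-principal ultrafilters $\omega$ and $\lim_\omega d_n=\infty$; a cut-point is a point whose removal disconnects the space. *)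

(* Defs.v *)
From HB Require Import structures.
From mathcomp Require Import all_boot all_order all_algebra.
From mathcomp Require Import all_classical all_reals all_analysis.

Set Implicit Arguments.
Unset Strict Implicit.
Unset Printing Implicit Defensive.

Import Order.TTheory GRing.Theory Num.Theory.
Import numFieldNormedType.Exports.

Local Open Scope classical_set_scope.
Local Open Scope card_scope.
Local Open Scope ring_scope.

(* Simple graphs, not necessarily locally finite.  A path from x to y is
   encoded, as in path.v, by the list of the vertices that follow x. *)
Record connected_graph := ConnectedGraph {
  vertex :> choiceType ;
  adj : rel vertex ;
  adj_sym : symmetric adj ;
  adj_irr : irreflexive adj ;
  adj_connected : forall x y, exists2 p, path adj x p & last x p = y }.

Section graph_distance.
Variable Gr : connected_graph.
Implicit Types x y z : Gr.

Definition walk x y n :=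
  exists p, [/\ path (@adj Gr) x p, last x p = y & size p = n].

Fact walk_exists x y : exists n, `[< walk x y n >].
Proof.
have [p xp pl] := adj_connected x y.
by exists (size p); apply/asboolP; exists p.
Qed.

Definition gdist x y : nat := ex_minn (walk_exists x y).

Lemma gdistP x y : walk x y (gdist x y).
Proof. by rewrite /gdist; case: ex_minnP => n /asboolP. Qed.

Lemma gdist_min x y n : walk x y n -> (gdist x y <= n)%N.
Proof. by rewrite /gdist; case: ex_minnP => m _ + w; apply; apply/asboolP. Qed.

Lemma gdistxx x : gdist x x = 0%N.
Proof. by apply/eqP; rewrite -leqn0; apply: gdist_min; exists [::]. Qed.

Lemma gdist_eq0 x y : gdist x y = 0%N -> x = y.
Proof. by move=> e; have := gdistP x y; rewrite e => -[[|z p] [_ /= xy]]. Qed.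

Lemma walk_sym x y n : walk x y n -> walk y x n.
Proof.
move=> [p [xp pl <-]]; exists (rev (belast x p)); split.
- rewrite -pl rev_path; apply: sub_path xp => u v /=.
  by rewrite adj_sym.
- by case: p pl {xp} => [|u p]//=; rewrite rev_cons last_rcons.
- by rewrite size_rev size_belast.
Qed.

Lemma gdist_sym x y : gdist x y = gdist y x.
Proof. by apply/eqP; rewrite eqn_leq !gdist_min//; apply/walk_sym/gdistP. Qed.

Lemma gdist_triangle y x z : (gdist x z <= gdist x y + gdist y z)%N.
Proof.
have [p [xp pl <-]] := gdistP x y; have [q [yq ql <-]] := gdistP y z.
apply: gdist_min; exists (p ++ q).
by rewrite cat_path last_cat pl xp yq size_cat.
Qed.

(* s is the list of all the vertices, from a to b, of a geodesic. *)
Definition geodesic (a b : Gr) (s : seq Gr) := exists p,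
  [/\ s = a :: p, path (@adj Gr) a p, last a p = b & size p = gdist a b].

End graph_distance.

(* The vertex set of a graph, with the (real-valued) graph metric. *)
Definition gmetric (R : realType) (Gr : connected_graph) : Type := Gr.

Section gmetric.
Variables (R : realType) (Gr : connected_graph).

HB.instance Definition _ := Choice.on (gmetric R Gr).

Let d (x y : gmetric R Gr) : R := (@gdist Gr x y)%:R.

Let d_xx x : d x x = 0. Proof. by rewrite /d gdistxx. Qed.

Let d_pos x y : d x y = 0 -> x = y.
Proof. by move/eqP; rewrite pnatr_eq0 => /eqP/gdist_eq0. Qed.

Let d_sym x y : d x y = d y x. Proof. by rewrite /d gdist_sym. Qed.

Let d_triangle y x z : d x z <= d x y + d y z.
Proof. by rewrite /d -natrD ler_nat; exact: gdist_triangle. Qed.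

HB.instance Definition _ :=
  isMetric.Build R (gmetric R Gr) d_xx d_pos d_sym d_triangle.

End gmetric.

Section bowditch_graph.
Variables (R : realType) (Gr : connected_graph).
Implicit Types a b c : Gr.

(* Geodesic triangles are delta-slim.  Sides may be rotated and traversed in
   either direction, so it is enough to look at the side from a to b. *)
Definition hyperbolic (delta : R) := forall a b c (p q r : seq Gr),
  geodesic a b p -> geodesic b c q -> geodesic c a r ->
  forall x, x \in p -> exists2 y, y \in q ++ r & (gdist x y)%:R <= delta.

Definition gball a (r : R) : set Gr := [set x | (gdist a x)%:R <= r].

Variable tight : set (seq Gr).

Definition tight_union a b (r : R) : set Gr :=
  [set x | exists a' b' s,
     [/\ gball a r a', gball b r b', tight s, geodesic a' b' s & x \in s]].

Record bowditch_graph : Prop := BowditchGraph {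
  bowditch_hyperbolic : exists2 delta : R, 0 <= delta & hyperbolic delta ;
  tight_geodesic : forall s, tight s -> exists a b, geodesic a b s ;
  tight_exists : forall a b, exists2 s, tight s & geodesic a b s ;
  bowditch_F0 : forall s t : seq Gr,
    t != [::] -> infix t s -> tight s -> tight t ;
  bowditch_F1 : forall r : R, 0 < r -> exists m k : nat, forall a b c,
    (k <= minn (gdist c a) (gdist c b))%N ->
    gball c r `&` tight_union a b r #<= `I_m }.

End bowditch_graph.

Record graph_action (G : groupType) (Gr : connected_graph) := GraphAction {
  act :> G -> Gr -> Gr ;
  act1 : forall x, act 1%g x = x ;
  actM : forall g h x, act (g * h)%g x = act g (act h x) ;
  act_adj : forall g x y, adj (act g x) (act g y) = adj x y }.

Record generating_set (G : groupType) := GeneratingSet {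
  gens : set G ;
  gens_finite : finite_set gens ;
  gens_generate : forall g : G, exists2 w : seq G,
    (forall s, s \in w -> gens s \/ gens s^-1%g) & g = (\prod_(s <- w) s)%g }.

Section cayley_graph.
Variables (G : groupType) (S : generating_set G).
Implicit Types g h : G.

Definition cayley_adj : rel G :=
  fun g h => (g != h) && `[< gens S (g^-1 * h)%g \/ gens S (h^-1 * g)%g >].

Fact cayley_sym : symmetric cayley_adj.
Proof.
by move=> g h; rewrite /cayley_adj eq_sym; congr (_ && _); apply/asboolP/asboolP;
  case; by [left|right].
Qed.

Fact cayley_irr : irreflexive cayley_adj.
Proof. by move=> g; rewrite /cayley_adj eqxx. Qed.

Fact cayley_connected g h :
  exists2 p, path cayley_adj g p & last g p = h.
Proof.
have [w wS ghw] := gens_generate S (g^-1 * h)%g.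
have -> : h = (g * \prod_(s <- w) s)%g by rewrite -ghw mulgA mulgV mul1g.
elim: w wS {ghw} g => [|s w IHw] wS g; first by exists [::]; rewrite ?big_nil ?mulg1.
have [|p gp pl] := IHw _ (g * s)%g.
  by move=> t tw; apply: wS; rewrite inE tw orbT.
rewrite big_cons mulgA.
have [gsg|gsg] := eqVneq g (g * s)%g; first by exists p; rewrite // {1}gsg.
exists (g * s :: p)%g => //=; rewrite gp andbT /cayley_adj gsg/=.
apply/asboolP; rewrite mulgA mulVg mul1g invgM -mulgA mulVg mulg1.
by apply: wS; rewrite mem_head.
Qed.

Definition cayley : connected_graph :=
  ConnectedGraph cayley_sym cayley_irr cayley_connected.

End cayley_graph.

(* (L, C)-quasi-isometric embeddings into X of a set I of parameters, placed on
   the real line by the coordinate c.  It is used with I a real interval, the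
   set of all integers, or an initial segment of the natural numbers. *)
Definition quasi_geodesic (R : realType) (X : metricType R) (L C : R)
    (A : Type) (c : A -> R) (I : set A) (q : A -> X) :=
  forall s t, I s -> I t ->
    `|c s - c t| / L - C <= mdist (q s) (q t) <= L * `|c s - c t| + C.

Section tight_action.
Variables (R : realType) (G : groupType) (S : generating_set G).
Variables (Gr : connected_graph) (tight : set (seq Gr)).
Variable rho : graph_action G Gr.

Definition shadows (Delta : set Gr) (s : seq Gr) (p : seq G) :=
  forall v, v \in s -> exists2 g, g \in p & exists2 y, Delta y & v = rho g y.

Definition tight_T1 := forall g, map (rho g) @` tight = tight.

(* The path joining g to h has the vertices g :: p. *)
Definition tight_T2 := forall o : Gr, exists (Delta : set Gr) (lambda kappa : R),
  [/\ finite_set Delta,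
      forall v, exists g, exists2 y, Delta y & v = rho g y,
      1 <= lambda, 0 <= kappa &
      forall g h : G, exists (p : seq G) (s : seq Gr),
        [/\ path (@adj (cayley S)) g p /\ last g p = h,
            @quasi_geodesic R (gmetric R (cayley S)) lambda kappa nat
              (fun i => i%:R) [set i | (i <= size p)%N] (nth g (g :: p)),
            tight s, geodesic (rho g o) (rho h o) s & shadows Delta s (g :: p)]].

Definition tight_action := tight_T1 /\ tight_T2.

Definition acylindrical := exists l N : nat, forall x y : Gr,
  (l <= gdist x y)%N -> [set g | rho g x = x /\ rho g y = y] #<= `I_N.

Definition loxodromic (g : G) := exists (x : Gr) (l : R),
  0 < l /\ (gdist x (rho (g ^+ n)%g x))%:R / n%:R @[n --> \oo] --> l.

End tight_action.

Definition expgz (G : groupType) (g : G) (n : int) : G :=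
  match n with Posz m => (g ^+ m)%g | Negz m => (g ^- m.+1)%g end.

Definition morse (R : realType) (X : metricType R) (q : int -> X) :=
  (exists L C : R, [/\ 1 <= L, 0 <= C & quasi_geodesic L C intr setT q]) /\
  forall L C : R, 1 <= L -> 0 <= C -> exists M : R,
    forall (a b : R) (p : R -> X), a <= b ->
      quasi_geodesic L C idfun `[a, b] p ->
      range q (p a) -> range q (p b) ->
      forall t, t \in `[a, b] -> exists n, mdist (p t) (q n) <= M.

(* Required in every Cayley graph of G; being Morse does not depend on the
   choice of the finite generating set. *)
Definition morse_element (R : realType) (G : groupType) (g : G) :=
  forall S : generating_set G,
    @morse R (gmetric R (cayley S)) (fun n => expgz g n).

Record cone_data (R : realType) (X : metricType R) := ConeData {
  cone_filter : set_system nat ;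
  cone_ultra : UltraFilter cone_filter ;
  cone_nonprincipal : forall n, cone_filter <> principal_filter n ;
  cone_base : nat -> X ;
  cone_scale : nat -> R ;
  cone_scale_cvg : cone_scale @ cone_filter --> +oo }.

#[global] Existing Instance cone_ultra.

Section asymptotic_cone.
Variables (R : realType) (X : metricType R) (D : cone_data X).
Local Notation omega := (cone_filter D).

Definition rescaled (x y : nat -> X) (n : nat) : R :=
  mdist (x n) (y n) / cone_scale D n.

Definition admissible (x : nat -> X) :=
  exists M : R, \forall n \near omega, rescaled (cone_base D) x n <= M.

Definition cone_seq := {x : nat -> X | `[< admissible x >]}.

HB.instance Definition _ := Choice.on cone_seq.

Definition ulim_dist (x y : cone_seq) : R :=
  lim (rescaled (val x) (val y) @ omega).

Lemma scale_gt0 : \forall n \near omega, 0 < cone_scale D n.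
Proof. exact: (cvgry_gt (@cone_scale_cvg _ _ D) 0). Qed.

Lemma ultra_bounded_cvg (u : nat -> R) (M : R) :
  (\forall n \near omega, `|u n| <= M) -> cvg (u @ omega).
Proof.
move=> uM.
have : (u @ omega) `[-M, M]%classic.
  by apply: filterS uM => n /=; rewrite in_itv/= -ler_norml.
move=> /(@segment_compact R (-M) M (u @ omega) _) [l [_ ul]].
apply/cvg_ex; exists l => A lA.
have [//|nA] := in_ultra_setVsetC (u @^-1` A) (@cone_ultra _ _ D).
by have [r [/=]] := ul (~` A) A nA lA.
Qed.

Lemma ulim_dist_cvg (x y : cone_seq) :
  rescaled (val x) (val y) @ omega --> ulim_dist x y.
Proof.
have [M Mx] := asboolW (valP x); have [N Ny] := asboolW (valP y).
apply: (@ultra_bounded_cvg _ (M + N)); near=> n.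
have s0 : 0 < cone_scale D n by near: n; exact: scale_gt0.
rewrite ger0_norm; last by rewrite divr_ge0 ?mdist_ge0 ?ltW.
apply: (@le_trans _ _
  (rescaled (cone_base D) (val x) n + rescaled (cone_base D) (val y) n)).
  rewrite /rescaled -mulrDl ler_pM2r ?invr_gt0//.
  by rewrite [mdist _ (val x n)]metric_sym metric_triangle.
by rewrite lerD//; near: n.
Unshelve. all: by end_near. Qed.

Lemma ulim_distxx x : ulim_dist x x = 0.
Proof.
rewrite /ulim_dist (_ : rescaled _ _ = cst 0) ?lim_cst//.
by apply/funext => n; rewrite /rescaled mdistxx mul0r.
Qed.

Lemma ulim_dist_sym x y : ulim_dist x y = ulim_dist y x.
Proof.
rewrite /ulim_dist (_ : rescaled (val x) _ = rescaled (val y) (val x))//.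
by apply/funext => n; rewrite /rescaled metric_sym.
Qed.

Lemma ulim_dist_triangle y x z :
  ulim_dist x z <= ulim_dist x y + ulim_dist y z.
Proof.
have xyz := cvgD (@ulim_dist_cvg x y) (@ulim_dist_cvg y z).
apply: (ler_cvg_to (@ulim_dist_cvg x z) (xyz _)).
near=> n; have s0 : 0 < cone_scale D n by near: n; exact: scale_gt0.
by rewrite /rescaled/= -mulrDl ler_pM2r ?invr_gt0// metric_triangle.
Unshelve. all: by end_near. Qed.

Lemma ulim_dist_ge0 x y : 0 <= ulim_dist x y.
Proof.
have z0 : cst (0 : R) n @[n --> omega] --> (0 : R) by exact: cvg_cst.
apply: (ler_cvg_to z0 (@ulim_dist_cvg x y)).
near=> n; have s0 : 0 < cone_scale D n by near: n; exact: scale_gt0.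
by rewrite divr_ge0 ?mdist_ge0 ?ltW.
Unshelve. all: by end_near. Qed.

Definition cone_equiv : rel cone_seq := fun x y => ulim_dist x y == 0.

Fact cone_equiv_refl : reflexive cone_equiv.
Proof. by move=> x; rewrite /cone_equiv ulim_distxx. Qed.

Fact cone_equiv_sym : symmetric cone_equiv.
Proof. by move=> x y; rewrite /cone_equiv ulim_dist_sym. Qed.

Fact cone_equiv_trans : transitive cone_equiv.
Proof.
move=> y x z /eqP xy /eqP yz; rewrite /cone_equiv eq_le ulim_dist_ge0 andbT.
by rewrite (le_trans (ulim_dist_triangle y x z))// xy yz addr0.
Qed.

Canonical cone_equiv_rel :=
  EquivRel cone_equiv cone_equiv_refl cone_equiv_sym cone_equiv_trans.

Definition asymptotic_cone : Type := {eq_quot cone_equiv_rel}%qT.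

HB.instance Definition _ := Choice.on asymptotic_cone.

Let d (P Q : asymptotic_cone) : R :=
  ulim_dist (generic_quotient.repr P) (generic_quotient.repr Q).

Let d_xx P : d P P = 0. Proof. exact: ulim_distxx. Qed.

Let d_pos P Q : d P Q = 0 -> P = Q.
Proof.
move=> PQ; rewrite -[P]generic_quotient.reprK -[Q]generic_quotient.reprK.
by apply/eqquotP; rewrite /= /cone_equiv -/(d P Q) PQ.
Qed.

Let d_sym P Q : d P Q = d Q P. Proof. exact: ulim_dist_sym. Qed.

Let d_triangle Q P P' : d P P' <= d P Q + d Q P'.
Proof. exact: ulim_dist_triangle. Qed.

HB.instance Definition _ :=
  isMetric.Build R asymptotic_cone d_xx d_pos d_sym d_triangle.

End asymptotic_cone.

Definition cut_point (T : topologicalType) (p : T) := ~ connected (~` [set p]).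

(* Main.v *)
(* Let g be loxodromic and consider the orbit of a vertex o under the powers of g: a
   quasi-geodesic, hence quasiconvex, subset of the hyperbolic graph, to which the nearest
   point projection is strongly contracting.  Consequently a path in G of length at most
   C (b - a) whose projection sweeps out the segment [a, b] of this axis must contain two
   elements h, h' at bounded distance in G whose orbit points are close to the axis but
   project far apart.  Since h^-1 h' takes finitely many values, (T1), (F1) and
   acylindricity leave only finitely many values for g^-l h, where l is the projection of
   h: the path comes within a distance of the cyclic subgroup that depends only on C.
   The maximal excursion of a quasi-geodesic away from the powers of g is therefore
   short, which is the Morse property.  In an asymptotic cone, a chain of points avoiding
   the base point and joining two points on both sides of it on the limit of an axis
   through it would lift to paths of linear length avoiding a linear part of that axis. *)

Require Import Defs.
From mathcomp Require Import all_boot all_order all_algebra.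
From mathcomp Require Import all_classical all_reals all_analysis.
From mathcomp Require Import zify lra.

Set Implicit Arguments.
Unset Strict Implicit.
Unset Printing Implicit Defensive.

Import Order.TTheory GRing.Theory Num.Theory.
Local Open Scope classical_set_scope.
Local Open Scope card_scope.

(** * Hyperbolic graphs *)

Section Betweenness.
Variable Gr : connected_graph.
Implicit Types a b c p q x y z : Gr.

Definition btw a p b := gdist a p + gdist p b = gdist a b.

Lemma btw_sym a p b : btw a p b -> btw b p a.
Proof. by rewrite /btw ![gdist b _]gdist_sym [gdist p a]gdist_sym addnC. Qed.

Lemma geodesic_btw a b s x : geodesic a b s -> x \in s -> btw a x b.
Proof.
move=> [p [-> ap pb sz]] xs.
apply/eqP; rewrite eqn_leq gdist_triangle andbT -sz.
move: xs ap pb; case/splitPl => p1 p2 <-; rewrite cat_path last_cat size_cat.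
move=> /andP[ap1 p2p] p2b.
by apply: leq_add; apply: gdist_min; [exists p1|exists p2].
Qed.

Lemma geodesic_exists a b : exists s, geodesic a b s.
Proof. by have [p [ap pb sz]] := gdistP a b; exists (a :: p), p. Qed.

Lemma btw_geodesic a p b : btw a p b -> exists2 s, geodesic a b s & p \in s.
Proof.
move=> apb; have [s [as_ sp ss]] := gdistP a p; have [t [pt tb st]] := gdistP p b.
exists (a :: (s ++ t)); last by rewrite -cat_cons mem_cat -sp mem_last.
by exists (s ++ t); rewrite cat_path last_cat sp as_ pt tb size_cat ss st.
Qed.

Lemma btw_at a b n : n <= gdist a b -> exists2 p, btw a p b & gdist a p = n.
Proof.
have [s [as_ sb ss]] := gdistP a b => nab.
pose t := take n s; pose p := last a t.
have d1 : gdist a p <= n.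
  rewrite (_ : n = size t); last by rewrite size_take ss; case: ltngtP nab.
  apply: gdist_min; exists t; split=> //.
  by move: as_; rewrite -{1}(cat_take_drop n s) cat_path => /andP[].
have d2 : gdist p b <= gdist a b - n.
  rewrite -ss -size_drop; apply: gdist_min; exists (drop n s); split=> //.
    by move: as_; rewrite -{1}(cat_take_drop n s) cat_path => /andP[].
  by rewrite -{1}sb -{2}(cat_take_drop n s) last_cat.
by exists p; rewrite /btw; have := gdist_triangle p a b; lia.
Qed.

Lemma btw_trans a b p q : btw a p b -> btw p q b -> btw a q b.
Proof.
rewrite /btw => apb pqb; have := gdist_triangle p a q.
by have := gdist_triangle q a b; lia.
Qed.

End Betweenness.

Lemma hyperbolic_slim (R : realType) (Gr : connected_graph) (delta : R) :
  hyperbolic Gr delta -> exists D : nat, forall (a b c p : Gr) q r,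
  btw a p b -> geodesic b c q -> geodesic c a r ->
  exists2 y, y \in q ++ r & gdist p y <= D.
Proof.
move=> hyp; exists (Num.bound `|delta|%R) => a b c p q r /btw_geodesic[s gs ps] gq gr.
have [y yqr py] := hyp _ _ _ _ _ _ gs gq gr _ ps; exists y => //.
have : ((gdist p y)%:R < (Num.bound `|delta|%R)%:R :> R)%R.
  apply: le_lt_trans py _; apply: (le_lt_trans (ler_norm _)).
  exact/archi_boundP/normr_ge0.
by rewrite ltr_nat => /ltnW.
Qed.

Section Slim.
Variables (Gr : connected_graph) (D : nat).
Implicit Types a b c p x y z : Gr.

(** The first side enters only through the betweenness of [p]; the other two stay explicit lists, so
    that a tight geodesic can serve as a side. *)
Definition slim := forall a b c p (q r : seq Gr),
  btw a p b -> geodesic b c q -> geodesic c a r ->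
  exists2 y, y \in q ++ r & gdist p y <= D.

Hypothesis sl : slim.

Lemma slim_triangle a b c p : btw a p b ->
  exists2 y, btw b y c \/ btw c y a & gdist p y <= D.
Proof.
move=> apb; have [q gq] := geodesic_exists b c; have [r gr] := geodesic_exists c a.
have [y] := sl apb gq gr; rewrite mem_cat => /orP yqr py.
by exists y => //; case: yqr => ys; [left|right]; apply: geodesic_btw ys.
Qed.

(** Cut the quadrilateral along the diagonal from [a] to [y]; each triangle costs [D]. The side [s]
    stays explicit because (F1) concerns tight geodesics only. *)
Lemma slim_quad a b y x s p : btw a p b -> geodesic x y s ->
  exists2 q, [\/ btw a q x, q \in s | btw y q b] & gdist p q <= 2 * D.
Proof.
move=> apb gs; have [q [bqy|yqa] pq] := slim_triangle y apb.
  by exists q; [constructor 3; apply: btw_sym|lia].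
have [r gr] := geodesic_exists a x.
have [z] := sl yqa gr gs; rewrite mem_cat => /orP zrs qz.
exists z; last by have := gdist_triangle q p z; lia.
by case: zrs => zs; [constructor 1; apply: geodesic_btw zs|constructor 2].
Qed.

Lemma slim_quad_btw a b y x p : btw a p b ->
  exists2 q, [\/ btw a q x, btw x q y | btw y q b] & gdist p q <= 2 * D.
Proof.
move=> apb; have [s gs] := geodesic_exists x y.
have [q qq pq] := slim_quad apb gs; exists q => //.
case: qq => qs; [by constructor 1| |by constructor 3].
by constructor 2; apply: geodesic_btw qs.
Qed.

Definition nearest (Y : Gr -> Prop) x y := Y y /\ forall z, Y z -> gdist x y <= gdist x z.

Definition quasiconvex (H : nat) (Y : Gr -> Prop) := forall y y' p,
  Y y -> Y y' -> btw y p y' -> exists2 z, Y z & gdist p z <= H.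

(** The midpoint of a geodesic from [y] to [y'] is near [Y] and near another side of the
    quadrilateral [y], [x], [x'], [y']. If that side joins [x] to [y] or [x'] to [y'], minimality
    bounds [gdist y y']; if it joins [x] to [x'], both are near [Y] up to [gdist x x']. *)
Lemma nearest_contract Y H x y x' y' : quasiconvex H Y ->
  nearest Y x y -> nearest Y x' y' ->
  gdist y y' <= 8 * D + 2 * H + 1 \/
  (gdist x y <= gdist x x' + 2 * D + H /\ gdist x' y' <= gdist x x' + 2 * D + H).
Proof.
move=> qc [Yy yx] [Yy' yx'].
have [|p ypy' yp] := @btw_at _ y y' (gdist y y')./2; first lia.
have [z Yz pz] := qc _ _ _ Yy Yy' ypy'.
have [q qq pq] := slim_quad_btw x' x ypy'.
have qz : gdist q z <= 2 * D + H.
  have := gdist_triangle p q z; rewrite (gdist_sym q p); lia.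
have := yx z Yz; have := yx' z Yz.
have := gdist_triangle q x z; have := gdist_triangle q x' z.
move: ypy'; rewrite /btw in qq *; case: qq => qq.
- have := gdist_triangle q y p; rewrite (gdist_sym q p) (gdist_sym x y) in qq *.
  rewrite (gdist_sym q x) in qq *; lia.
- rewrite (gdist_sym q x') in qq *; lia.
- have := gdist_triangle q p y'; lia.
Qed.

End Slim.

(** * Quasi-geodesic lines in a hyperbolic graph *)

Lemma sqr_le_expn2 n : n * n <= 4 * 2 ^ n.
Proof.
elim: n => // -[|[|[|n]]] // IH.
by move: IH; rewrite [2 ^ n.+4]expnS; nia.
Qed.

(** For [k] just above the logarithm of [A * n], the hypothesis bounds [n] by an affine function of
    that logarithm, so [n] is bounded. *)
Lemma exp_beats_linear A c d : exists H, forall n,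
  (forall k, A * n <= 2 ^ k -> n <= c + d * k) -> n <= H.
Proof.
exists (c + d + d * (4 * A * (c + 2 * d))) => n hn.
pose t := trunc_log 2 (A * n).
have [/eqP An0|An0] := posnP (A * n).
  have := hn 0; rewrite (eqP An0) muln0 addn0 => /(_ isT); lia.
have /andP[tl tu] := trunc_log_bounds (isT : 1 < 2) An0.
have {hn} := hn t.+1 (ltnW tu) => hn.
(* Here [t * t <= 4 * 2 ^ t <= 4 * A * n] and [n <= (c + 2 * d) * t]; cancel [t]. *)
suff : t <= 4 * A * (c + 2 * d) by rewrite -/t in hn *; nia.
have [->//|t0] := posnP t.
rewrite -(leq_pmul2r t0); apply: leq_trans (sqr_le_expn2 t) _.
have {}tl : 2 ^ t <= A * n := tl.
have : n <= (c + 2 * d) * t by nia.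
by nia.
Qed.

Section Stability.
Variables (Gr : connected_graph) (D : nat).
Hypothesis sl : slim Gr D.
Variables (f : int -> Gr) (e A : nat).
Hypothesis f_step : forall i, gdist (f i) (f (i + 1)%R) <= e.
Hypothesis f_lower : forall i j, `|i - j|%N <= A * gdist (f i) (f j).

(** Bisect the parameter interval: each slim triangle costs [D] and halves the interval, until a
    single step of the orbit is left. *)
Lemma near_of_log k : forall i (N : nat) p, N <= 2 ^ k ->
  btw (f i) p (f (i + N%:Z)%R) -> exists j, gdist p (f j) <= D * k + e.
Proof.
elim: k => [|k IH] i N p Nk b.
  exists i; have : gdist (f i) (f (i + N%:Z)%R) <= e.
    by case: N Nk b => [|[|//]] _ _; rewrite ?addr0 ?gdistxx// f_step.
  by move: b; rewrite /btw (gdist_sym p (f i)); lia.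
have N2 : (i + N%:Z = i + (N./2)%:Z + (N - N./2)%:Z)%R by lia.
have [y yy py] := slim_triangle sl (f (i + (N./2)%:Z)%R) b.
suff [j yj] : exists j, gdist y (f j) <= D * k + e.
  by exists j; have := gdist_triangle y p (f j); lia.
rewrite expnS in Nk.
case: yy => /btw_sym yy.
  by apply: (IH (i + (N./2)%:Z)%R (N - N./2)); [lia|rewrite -N2].
by apply: (IH i N./2 y) => //; lia.
Qed.

Let Y z := exists k, z = f k.

(* At a point p of the geodesic at maximal distance n from the orbit, cut the geodesic
   at distance 2n on both sides: the resulting detour through the orbit is at
   distance n from p but only linearly long in n, against near_of_log. *)
Lemma quasiconvex_orbit : exists H, quasiconvex H Y.
Proof.
have [H HP] := exp_beats_linear (6 * A) (2 * D + e) D.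
exists H => _ _ p0 [i ->] [j ->] b0.
pose P n := `[< exists2 p, btw (f i) p (f j) & forall k, n <= gdist p (f k) >].
have P0 : exists n, P n by exists 0; apply/asboolP; exists p0.
have PM n : P n -> n <= gdist (f i) (f j).
  by move=> /asboolP[p + /(_ i)]; rewrite /btw (gdist_sym p (f i)); lia.
case: (ex_maxnP P0 PM) => n /asboolP[p bp pn] nmax {P0 PM}.
have near y : btw (f i) y (f j) -> exists k, gdist y (f k) <= n.
  move=> by_; apply: contrapT => no.
  have : n.+1 <= n; last by rewrite ltnn.
  apply: nmax; apply/asboolP; exists y => // k.
  by rewrite ltnNge; apply/negP => yk; apply: no; exists k.
suff nH : n <= H.
  by have [k pk] := near _ b0; exists (f k); [exists k|exact: leq_trans nH].
have cut a k0 : a = f k0 -> btw (f i) a (f j) ->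
    (forall y, btw a y p -> btw (f i) y (f j)) ->
  exists y k, [/\ btw a y p, gdist y p <= 2 * n, gdist y (f k) <= n &
     forall q, btw y q (f k) -> n <= gdist p q].
  move=> ak0 ba bap; have [le2n|gt2n] := leqP (gdist a p) (2 * n).
    exists a, k0; rewrite ak0 gdistxx; split=> //; first by rewrite /btw gdistxx.
      by rewrite -ak0.
    move=> q qq; have -> : q = f k0; last by rewrite pn.
    by apply: gdist_eq0; move: qq; rewrite /btw gdistxx; lia.
  have [|y ay aye] := @btw_at _ a p (gdist a p - 2 * n); first lia.
  have [k yk] := near _ (bap _ ay); exists y, k; split=> //.
    by move: ay; rewrite /btw; lia.
  move=> q; rewrite /btw => qq; move: ay; rewrite /btw => ay.
  by have := gdist_triangle q y p; rewrite (gdist_sym q p); lia.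
have [|||y [k1 [y1 y2 y3 y4]]] := cut (f i) i => //.
- by rewrite /btw gdistxx.
- by move=> y ypa; apply/btw_sym/(@btw_trans _ _ _ p); apply/btw_sym.
have [|||z [k2 [z1 z2 z3 z4]]] := cut (f j) j => //.
- by rewrite /btw gdistxx addn0.
- by move=> z zpb; apply: (@btw_trans _ _ _ p) => //; apply/btw_sym.
have bypz : btw y p z.
  move: bp y1 z1; rewrite /btw.
  rewrite (gdist_sym (f j) z) (gdist_sym (f j) p) (gdist_sym z p).
  have := gdist_triangle y (f i) z; have := gdist_triangle z (f i) (f j).
  by have := gdist_triangle p y z; lia.
(* The connectors have length at most [n] and [y], [z] are at most [4 * n] apart, whence the factor
   [6 * A]. If the side met is a connector, then [n <= 2 * D]. *)
apply: HP => k kn.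
have k12 : `|k1 - k2| <= 2 ^ k.
  apply: leq_trans (f_lower _ _) _; apply: leq_trans kn.
  rewrite (mulnC 6) -mulnA leq_mul2l; apply/orP; right.
  have := gdist_triangle y (f k1) (f k2); have := gdist_triangle z y (f k2).
  have := gdist_triangle p y z.
  by rewrite (gdist_sym (f k1) y) (gdist_sym p z); lia.
have [q qq pq] := slim_quad_btw sl (f k2) (f k1) bypz.
case: qq => qq; [by have := y4 _ qq; lia| |by have := z4 _ (btw_sym qq); lia].
have [l ql] : exists l, gdist q (f l) <= D * k + e.
  have [k12'|k21] := boolP (k1 <= k2)%R.
    apply: (@near_of_log k k1 `|k1 - k2| q k12).
    by rewrite (_ : (k1 + _)%R = k2)//; lia.
  apply: (@near_of_log k k2 `|k1 - k2| q k12).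
  by rewrite (_ : (k2 + _)%R = k1) //; [exact: btw_sym|lia].
by have := pn l; have := gdist_triangle q p (f l); lia.
Qed.

(** [f_lower] turns distances between nearest points into differences of parameters. The second
    clause is strong contraction: a move shorter than the distance to the orbit, up to [L], shifts
    the projection by at most [B]. *)
Lemma orbit_projection : exists (pr : Gr -> int) (B L : nat),
  [/\ forall x k, gdist x (f (pr x)) <= gdist x (f k),
      forall x x', `|pr x - pr x'| <= B \/ gdist x (f (pr x)) <= gdist x x' + L
    & forall x x', `|pr x - pr x'| <= B * (gdist x x').+1].
Proof.
have [H qc] := quasiconvex_orbit.
have /choice[pr prP] x : exists k, forall l, gdist x (f k) <= gdist x (f l).
  have ex0 : exists n, `[< exists k, gdist x (f k) = n >].
    by exists (gdist x (f 0%R)); apply/asboolP; exists 0%R.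
  case: (ex_minnP ex0) => n /asboolP[k <-] nmin.
  by exists k => l; apply: nmin; apply/asboolP; exists l.
have prN x : nearest Y x (f (pr x)).
  by split; [exists (pr x)|move=> _ [k ->]].
exists pr, (A * (8 * D + 2 * H + 3 + 2 * (2 * D + H))), (2 * D + H).
split=> // x x'; have := f_lower (pr x) (pr x');
  case: (nearest_contract sl qc (prN x) (prN x')) => [yy'|[xy xy']] pp.
- by left; apply: leq_trans pp _; rewrite leq_mul2l; lia.
- by right; lia.
- by apply: leq_trans pp _; rewrite -mulnA leq_mul2l; nia.
- apply: leq_trans pp _; rewrite -mulnA leq_mul2l.
  have := gdist_triangle x (f (pr x)) (f (pr x')).
  have := gdist_triangle x' x (f (pr x')).
  by rewrite (gdist_sym (f (pr x)) x); nia.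
Qed.

End Stability.

(** * Average speed of an integer sequence that is slow except at near times *)

Section Speed.
Variables (q : nat -> int) (near : nat -> Prop) (M : nat) (B1 B2 K C : nat).
Hypothesis far_step : forall m, m < M -> ~ near m -> (q m.+1 - q m <= B1%:Z)%R.
Hypothesis any_step : forall m, m < M -> (q m.+1 - q m <= B2%:Z)%R.
Hypothesis near_near : forall m m', m < m' -> m' <= M -> m' - m <= C ->
  near m -> near m' -> (q m' - q m <= K%:Z)%R.

(** Let [m0] and [m1] be the first and last near times of the block: a step outside them gains at
    most [B1], all steps between them at most [K], and the step leaving [m1] at most [B2]. *)
Lemma block_speed m t : m + t <= M -> t <= C ->
  (q (m + t) - q m <= (t * B1 + K + B2)%:Z)%R.
Proof.
move=> tM tC.
suff : (q (m + t) - q m <= (t * B1)%:Z)%R \/ exists m0 m1,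
    [/\ m <= m0 <= m1, m1 < m + t, near m0 /\ near m1,
        (q m0 - q m <= ((m0 - m) * B1)%:Z)%R &
        (q (m + t) - q m1 <= (B2 + (m + t - m1.+1) * B1)%:Z)%R].
  case=> [|[m0 [m1 [/andP[h0 h1] h2 [n0 n1] h3 h4]]]]; first lia.
  have h5 : (q m1 - q m0 <= K%:Z)%R.
    have [->|ne] := eqVneq m0 m1; first lia.
    by apply: near_near => //; lia.
  have : (m0 - m) * B1 + (m + t - m1.+1) * B1 <= t * B1.
    by rewrite -mulnDl leq_mul2r; lia.
  by lia.
elim: t tM tC => [|t IH] tM tC; first by left; rewrite addn0; lia.
have [qt|[m0 [m1 [h0 h2 [n0 n1] h3 h4]]]] := IH ltac:(lia) ltac:(lia).
- have [nt|ft] := pselect (near (m + t)).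
    right; exists (m + t), (m + t); rewrite !addnS leqnn leq_addr subnn.
    split=> //; first by rewrite addKn; lia.
    by have := @any_step (m + t) ltac:(lia); lia.
  by left; have := @far_step (m + t) ltac:(lia) ft; rewrite addnS mulSn; lia.
- right; have [nt|ft] := pselect (near (m + t)).
    exists m0, (m + t); rewrite !addnS subnn; split=> //; try lia.
    by have := @any_step (m + t) ltac:(lia); lia.
  exists m0, m1; split=> //; try lia.
  have := @far_step (m + t) ltac:(lia) ft; rewrite addnS.
  have -> : (m + t).+1 - m1.+1 = (m + t - m1.+1).+1 by lia.
  by rewrite mulSn; lia.
Qed.

(** In a block of length [C] the extra [K + B2] is at most [C * B1] and only doubles the speed; the
    last partial block accounts for the added [C]. *)
Lemma mean_speed : 0 < C -> K + B2 <= C * B1 ->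
  (q M - q 0 <= (2 * B1 * (M + C))%:Z)%R.
Proof.
move=> C0 KB.
suff H t : forall m, m + t = M -> (q M - q m <= (2 * B1 * (t + C))%:Z)%R.
  exact: H.
elim/ltn_ind: t => t IH m mt; have [tC|Ct] := leqP t C.
  have := block_speed (eq_leq mt) tC; rewrite mt.
  have : t * B1 <= C * B1 by rewrite leq_mul2r tC orbT.
  by rewrite mulnDr -!mulnA ![B1 * _]mulnC; lia.
have := IH (t - C) ltac:(lia) (m + C) ltac:(lia).
have := @block_speed m C ltac:(lia) (leqnn _).
have -> : 2 * B1 * (t + C) = 2 * B1 * (t - C + C) + 2 * (C * B1).
  by rewrite -[in LHS](subnK (ltnW Ct)) !mulnDr; lia.
by lia.
Qed.

End Speed.

(** * The action *)

Lemma finite_set_bounded (T : eqType) (A : set T) (F : T -> nat) :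
  finite_set A -> exists e, forall x, A x -> F x <= e.
Proof.
move=> /finite_seqP[s ->]; exists (\max_(x <- s) F x) => x /= xs.
by rewrite (big_rem x)//= leq_maxl.
Qed.

Lemma finite_set_absz_le T : finite_set [set k : int | (`|k| <= T)%N].
Proof.
apply: (@sub_finite_set _ _ ((fun n : nat => (n%:Z - T%:Z)%R) @` `I_(T.*2.+1))).
  by move=> k /= kT; exists (absz (k + T%:Z)%R) => /=; lia.
exact/finite_image/finite_II.
Qed.

Section Actions.
Variables (G : groupType) (Gr : connected_graph) (rho : graph_action G Gr).
Implicit Types (g h u : G) (x y z : Gr).

Lemma actK g x : rho g^-1%g (rho g x) = x.
Proof. by rewrite -actM mulVg act1. Qed.

Lemma gdist_act g x y : gdist (rho g x) (rho g y) = gdist x y.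
Proof.
suff le h z t : (gdist (rho h z) (rho h t) <= gdist z t)%N.
  by apply/eqP; rewrite eqn_leq le -{1}[x](actK g) -{1}[y](actK g) le.
have [p [zp pt sp]] := gdistP z t; apply: gdist_min.
exists (map (rho h) p); rewrite size_map last_map pt; split=> //.
by rewrite path_map; apply: sub_path zp => a b; rewrite /= act_adj.
Qed.

Lemma geodesic_act g x y s :
  geodesic x y s -> geodesic (rho g x) (rho g y) (map (rho g) s).
Proof.
move=> [p [-> xp py sp]]; exists (map (rho g) p); split=> //=.
- by rewrite path_map; apply: sub_path xp => a b; rewrite /= act_adj.
- by rewrite last_map py.
- by rewrite size_map gdist_act.
Qed.

End Actions.

Section IntegerPowers.
Variables (G : groupType) (g : G).

Lemma expgzSr m : expgz g (m + 1)%R = (expgz g m * g)%g.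
Proof.
case: m => [m|[|m]] /=; first by rewrite addn1 expgSr.
  by rewrite expg1 mulVg.
by rewrite subn1/= [(g ^+ m.+2)%g]expgS invgM -mulgA mulVg mulg1.
Qed.

Lemma expgzD m n : expgz g (m + n)%R = (expgz g m * expgz g n)%g.
Proof.
elim/int_rect: n => [|n IH|n IH]; first by rewrite addr0 mulg1.
  have -> : (m + n.+1%:Z = m + n%:Z + 1)%R by lia.
  by rewrite expgzSr IH -mulgA -expgzSr intS addrC.
apply: (mulIg g); rewrite -mulgA -!expgzSr.
have -> : (m - n.+1%:Z + 1 = m - n%:Z)%R by lia.
by have -> : (- n.+1%:Z + 1 = - n%:Z)%R by lia.
Qed.

Lemma expgzN m : expgz g (- m)%R = (expgz g m)^-1%g.
Proof.
apply: (mulIg (expgz g m)); rewrite mulVg -expgzD.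
by have -> : (- m + m = 0)%R by lia.
Qed.

End IntegerPowers.

Section ProductSets.
Variable G : groupType.
Implicit Types (E : set G) (h : nat -> G).

Fixpoint iter_prod E (n : nat) : set G :=
  if n is m.+1 then
    iter_prod E m `|` \bigcup_(x in iter_prod E m) ((fun y => x * y)%g @` E)
  else [set 1%g].

Lemma finite_iter_prod E n : finite_set E -> finite_set (iter_prod E n).
Proof.
move=> fE; elim: n => [|n IH] /=; first exact: finite_set1.
rewrite finite_setU; split=> //; apply: bigcup_finite => // x _.
exact: finite_image.
Qed.

(** For finite [E], displacements over at most [T] steps thus take finitely many values. *)
Lemma iter_prod_steps E h n k t T : (forall k, k < n -> E ((h k)^-1 * h k.+1)%g) ->
  k + t <= n -> t <= T -> iter_prod E T ((h k)^-1 * h (k + t))%g.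
Proof.
move=> hE kn tT; rewrite -(subnK tT) addnC; elim: (T - t) => [|d IH]; last first.
  by rewrite addnS; left.
rewrite addn0; elim: t kn {tT} => [|t IH] kn; first by rewrite addn0 mulVg.
rewrite addnS; right; exists ((h k)^-1 * h (k + t))%g; first by apply: IH; lia.
exists ((h (k + t))^-1 * h (k + t).+1)%g; first by apply: hE; lia.
by rewrite mulgA mulgK.
Qed.

End ProductSets.

(** * Finiteness of coarse transporters *)

Section WeakProperDiscontinuity.
Variables (R : realType) (G : groupType) (Gr : connected_graph).
Variables (tight : set (seq Gr)) (rho : graph_action G Gr).
Hypothesis bow : bowditch_graph R tight.
Hypothesis T1 : tight_T1 tight rho.
Hypothesis acy : acylindrical rho.

(** A transporter is empty or a left coset of the common stabilizer of [x] and [y]. *)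
Lemma finite_transporter l N : (forall x y : Gr, (l <= gdist x y)%N ->
    [set g | rho g x = x /\ rho g y = y] #<= `I_N) ->
  forall x y x' y', (l <= gdist x y)%N ->
  finite_set [set g | rho g x = x' /\ rho g y = y'].
Proof.
move=> fix_fin x y x' y' lxy.
have [[g0 [<- <-]]|no] := pselect (exists g0, rho g0 x = x' /\ rho g0 y = y'); last first.
  by rewrite (_ : mkset _ = set0)//; apply/seteqP; split => // g gg; apply: no; exists g.
apply: (@sub_finite_set _ _ ((fun g => g0 * g)%g @` [set g | rho g x = x /\ rho g y = y])).
  move=> g /= [gx gy]; exists (g0^-1 * g)%g; last by rewrite mulgA mulgV mul1g.
  by rewrite !actM gx gy !actK.
exact/finite_image/(card_le_finite (fix_fin _ _ lxy))/finite_II.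
Qed.

(* For such u, the translate by u of one fixed tight geodesic from y to z fellow-travels
   [a, b], so (F1) leaves finitely many values for the images of two far apart
   vertices of it. *)
Lemma finite_coarse_transporter r : exists D0, forall a b, D0 <= gdist a b ->
  forall y z, finite_set [set u | (gdist a (rho u y) <= r)%N /\ (gdist b (rho u z) <= r)%N].
Proof.
have [delta _ /hyperbolic_slim[D sl]] := bowditch_hyperbolic bow.
have [l [N lN]] := acy.
(* The successor makes the radius positive, as (F1) requires. *)
pose r' := (r + 2 * D).+1.
have [m [k F1]] := bowditch_F1 bow (ltr0Sn R (r + 2 * D)).
(* [k] serves (F1); [2 * r'] keeps points at distance [K] from both ends away from the two short
   sides, of length at most [r]. *)
have [K kK rK] : exists2 K, k <= K & 2 * r' <= K.
  by exists (maxn k (2 * r')); rewrite ?leq_maxl ?leq_maxr.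
have r'E : r' = (r + 2 * D).+1 by [].
(* Room for [c1] and [c2] at distance [l + 2 * r'], both at least [K] from the ends: vertices within
   [r'] of them are at least [l] apart. *)
exists (2 * K + l + 2 * r') => a b ab y z.
have [s ts gs] := tight_exists bow y z.
have [|c1 ac1b ac1] := @btw_at _ a b K; first lia.
move: (ac1b); rewrite /btw ac1 => c1b.
have [|c2 c12b c12] := @btw_at _ c1 b (l + 2 * r'); first lia.
move: (c12b); rewrite /btw c12 => c2b.
have ac2b := btw_trans ac1b c12b.
have ac2 : K <= gdist a c2 by move: ac2b; rewrite /btw; lia.
have tu u : tight (map (rho u) s) by rewrite -(T1 u); exists s.
have close u c : btw a c b -> (K <= gdist a c)%N -> (K <= gdist c b)%N ->
    (gdist a (rho u y) <= r)%N -> (gdist b (rho u z) <= r)%N ->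
  exists2 x, x \in s & (@gball R Gr c r'%:R%R `&` @tight_union R Gr tight a b r'%:R%R) (rho u x).
  move=> acb ac cb uy uz.
  have [q qq cq] := slim_quad sl acb (geodesic_act rho u gs).
  have {qq} /mapP[x xs qx] : q \in map (rho u) s.
    case: qq => // qq; move: qq; rewrite /btw => qq; exfalso.
      by have := gdist_triangle q a c; rewrite (gdist_sym q c); lia.
    by have := gdist_triangle q c b; rewrite (gdist_sym b) in uz; lia.
  exists x => //; rewrite -qx; split; first by rewrite /gball /= ler_nat; lia.
  exists (rho u y), (rho u z), (map (rho u) s).
  by rewrite /gball /= !ler_nat; split; [lia|lia|by []|exact: geodesic_act|rewrite qx map_f].
have finF c : btw a c b -> (K <= gdist a c)%N -> (K <= gdist c b)%N ->
  finite_set (@gball R Gr c r'%:R%R `&` @tight_union R Gr tight a b r'%:R%R).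
  move=> acb ac cb; apply: (card_le_finite (F1 a b c _)); last exact: finite_II.
  by rewrite (gdist_sym c a); lia.
set F := fun c => @gball R Gr c r'%:R%R `&` @tight_union R Gr tight a b r'%:R%R in close finF.
(* Record [u] by two vertices of [s] and their images: finitely many choices by (F1), each leaving
   finitely many [u]. *)
apply: (@sub_finite_set _ _ (\bigcup_(x1 in [set` s]) \bigcup_(x2 in [set` s])
    \bigcup_(y1 in F c1) \bigcup_(y2 in F c2)
      [set u | (l <= gdist x1 x2)%N /\ (rho u x1 = y1 /\ rho u x2 = y2)])); last first.
  apply: bigcup_finite => [|x1 _]; first exact: finite_seq.
  apply: bigcup_finite => [|x2 _]; first exact: finite_seq.
  apply: bigcup_finite => [|y1 _]; first by apply: finF => //; lia.
  apply: bigcup_finite => [|y2 _]; first by apply: finF => //; lia.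
  have [lx|nlx] := leqP l (gdist x1 x2).
    by apply: sub_finite_set (finite_transporter lN y1 y2 lx) => u [].
  by apply: sub_finite_set (@finite_set0 _) => u [].
move=> u /= [uy uz].
have [|||//|//|x1 x1s F1x] := close u c1 => //; try lia.
have [|||//|//|x2 x2s F2x] := close u c2 => //; try lia.
exists x1 => //; exists x2 => //; exists (rho u x1) => //; exists (rho u x2) => //=.
split=> //; rewrite -(gdist_act rho u).
move: (F1x.1) (F2x.1); rewrite /gball /= !ler_nat => c1x c2x.
have := gdist_triangle (rho u x1) c1 c2; have := gdist_triangle (rho u x2) (rho u x1) c2.
by rewrite (gdist_sym (rho u x2) c2); lia.
Qed.

End WeakProperDiscontinuity.

(** By subadditivity [l] is at most [d n / n] for every positive [n], so the lower bound needs no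
    additive constant. *)
Lemma loxodromic_lower (R : realType) (G : groupType) (Gr : connected_graph)
    (rho : graph_action G Gr) (g : G) : loxodromic R rho g ->
  exists (o : Gr) (A : nat), forall i j : int,
    (`|i - j| <= A * gdist (rho (expgz g i) o) (rho (expgz g j) o))%N.
Proof.
move=> [x [l [l0 cvl]]]; pose d n := gdist x (rho (g ^+ n)%g x).
have dM n m : d (m * n) <= m * d n.
  elim: m => [|m IH]; first by rewrite mul0n /d expg0 act1 gdistxx.
  rewrite mulSn /d addnC expgnDr; apply: leq_trans (gdist_triangle (rho (g ^+ (m * n))%g x) _ _) _.
  by rewrite actM gdist_act mulSn addnC leq_add2l.
have ld n : (l * n%:R <= (d n)%:R)%R.
  have [->|n0] := posnP n; first by rewrite mulr0.
  rewrite -ler_pdivlMr ?ltr0n// leNgt; apply/negP => dl.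
  (* Along multiples of [n] the quotient never exceeds [d n / n], so its limit cannot be larger. *)
  move/cvgrPdist_lt: cvl => /(_ (l - (d n)%:R / n%:R)%R); rewrite subr_gt0 => /(_ dl).
  move=> [N _] /(_ (N.+1 * n)) /=; rewrite -/(d _).
  have NN : (N <= N.+1 * n)%N by nia.
  move/(_ NN) => H; have {}H := le_lt_trans (ler_norm _) H.
  move: H; rewrite ltrD2l ltrN2 ltNge => /negP; apply.
  rewrite ler_pdivrMr ?ltr0n ?muln_gt0// natrM mulrA mulrAC divfK ?pnatr_eq0 -?lt0n//.
  by rewrite mulrC -natrM ler_nat dM.
pose A := Num.bound l^-1; exists x, A => i j.
have dA n : (n <= A * d n)%N.
  rewrite -(ler_nat R) natrM -(ler_pM2l l0) mulrCA mulrA.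
  apply: le_trans (ld n) _; rewrite ler_peMl// mulrC -ler_pdivrMl// mulr1.
  by apply/ltW/archi_boundP; rewrite invr_ge0 ltW.
have dij : forall i j : int, (i <= j)%R ->
    gdist (rho (expgz g i) x) (rho (expgz g j) x) = d `|j - i|%N.
  move=> {}i {}j ij; rewrite /d -(gdist_act rho (expgz g (- i)%R)) -!actM -!expgzD addNr act1.
  by have -> : (- i + j = `|j - i|%N%:Z)%R by lia.
have [ij|ji] := boolP (i <= j)%R; first by rewrite dij// distnC dA.
by rewrite gdist_sym dij; [exact: dA|lia].
Qed.

(** Clamping projections discards progress along the axis outside [[a, b]]. *)
Definition clamp (a b x : int) : int :=
  (if x < a then a else if b < x then b else x)%R.

Lemma clampP a b x : (a <= b)%R -> ((x < a) /\ clamp a b x = a \/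
  (b < x) /\ clamp a b x = b \/ (a <= x <= b) /\ clamp a b x = x)%R.
Proof. by rewrite /clamp; case: ltP => ?; [left|case: ltP => ?; right; [left|right]]; lia. Qed.

(** Up to constants, [q] has to gain [b - a], but its drift is at most half of that. *)
Lemma slow_drift_absurd (A c B C x : nat) (a b q0 qM : int) :
  (q0 <= a + (2 * A * c)%:Z)%R -> (b <= qM + (2 * A * c)%:Z)%R ->
  ((4 * B * x)%:Z <= b - a)%R -> (qM - q0 <= (2 * (B * x) + 2 * B * (1 + C))%:Z)%R ->
  (a + (2 * (4 * A * c + 2 * B * (2 + C))).+1%:Z <= b)%R -> False.
Proof. lia. Qed.

(* Steps of a path that is short compared with b - a make, on average, fast progress
   along the axis; the projection to the axis being contracting, the path has to be
   near the axis at two times that are close to each other but project far apart.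
   The displacement between these two times takes finitely many values, and
   finite_coarse_transporter applies. *)
Lemma short_path_meets_axis (R : realType) (G : groupType) (Gr : connected_graph)
    (tight : set (seq Gr)) (rho : graph_action G Gr) (g : G) :
  bowditch_graph R tight -> tight_T1 tight rho -> acylindrical rho ->
  loxodromic R rho g ->
  forall (E : set G) (C : nat), finite_set E ->
  exists2 U : set G, finite_set U & forall V : set G, finite_set V ->
  exists n0 : nat, forall (h : nat -> G) (n : nat) (i j a b : int),
    (forall k, (k < n)%N -> E ((h k)^-1 * h k.+1)%g) ->
    V ((expgz g i)^-1 * h 0)%g -> V ((expgz g j)^-1 * h n)%g ->
    (n%:Z <= C%:Z * (b - a))%R ->
    (i <= a)%R -> (b <= j)%R -> (a + n0%:Z <= b)%R ->
    exists k l, [/\ (k <= n)%N, (a <= l <= b)%R & U ((expgz g l)^-1 * h k)%g].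
Proof.
move=> bow T1 acy lox E C fE.
have [ o [A f_lower]] := loxodromic_lower lox.
pose f k := rho (expgz g k) o.
have [delta _ /hyperbolic_slim[D sl]] := bowditch_hyperbolic bow.
have f_step i : gdist (f i) (f (i + 1)%R) <= gdist o (rho g o).
  by rewrite /f expgzSr actM gdist_act.
have [pr [B [L [prmin pr_far pr_lip]]]] := orbit_projection sl f_step f_lower.
have [e eP] := finite_set_bounded (fun s => gdist o (rho s o)) fE.
(* Sampling every [tau] steps gives at most [(b - a) / (4 * B1)] full intervals, against a mean
   speed of [2 * B1]. Farther than [r] from the axis, one interval shifts the projection by at most
   [B]. *)
pose B1 := B.+1; pose tau := 4 * B1 * C.+1; pose r := e * tau + L.
have [D0 wpd] := finite_coarse_transporter bow T1 acy r.
(* [B2] bounds the shift in any interval; projections more than [K] apart belong to axis points at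
   least [D0] apart; [C3] is a block length for [mean_speed]. *)
pose B2 := B * (e * tau).+1; pose K := A * D0; pose C3 := (K + B2).+1.
pose T := C3 * B2.
(* [u] is the position of a near sample relative to its projection, [w] the displacement to a later
   near sample, [k] the gap between their projections. *)
pose U0 := \bigcup_(w in iter_prod E (C3 * tau))
  \bigcup_(k in [set k : int | (`|k| <= T)%N])
    [set u | (K < `|k|)%N /\ ((gdist o (rho u o) <= r)%N /\
                             (gdist (f k) (rho u (rho w o)) <= r)%N)].
have fU0 : finite_set U0.
  apply: bigcup_finite => [|w _]; first exact: finite_iter_prod.
  apply: bigcup_finite => [|k _]; first exact: finite_set_absz_le.
  have [Kk|kK] := ltnP K `|k|; last by apply: sub_finite_set (@finite_set0 _) => u []; lia.
  apply: sub_finite_set (wpd o (f k) _ o (rho w o)) => [u []//|].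
  have := f_lower 0%R k; rewrite act1 sub0r abszN -/(f k) /= => Ak.
  by rewrite leqNgt; apply/negP => kD; move: Kk; rewrite /K; nia.
(* The extra power of [g] passes from a projection to its clamped value. *)
exists (\bigcup_(k in [set k : int | (`|k| <= T)%N]) ((fun u => expgz g k * u)%g @` U0)).
  apply: bigcup_finite => [|k _]; first exact: finite_set_absz_le.
  exact: finite_image.
move=> V /(finite_set_bounded (fun s => gdist o (rho s o)))[c cP].
exists (2 * (4 * A * c + 2 * B1 * (2 + C3))).+1.
move=> h n i j a b hE Vi Vj nab ia bj ab.
pose M := (n %/ tau).+1.
(* Truncation at [n] makes the sample numbered [M] the end of the path. *)
pose t m := minn (m * tau) n.
pose z m := rho (h (t m)) o.
pose near m := gdist (z m) (f (pr (z m))) <= r.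
pose q m := clamp a b (pr (z m)).
have tau0 : 0 < tau by rewrite !muln_gt0.
have tM : t M = n.
  by apply/minn_idPr; rewrite /M mulSn; have := ltn_pmod n tau0; have := divn_eq n tau; lia.
have tS m : t m <= t m.+1 <= n /\ t m.+1 - t m <= tau by rewrite /t mulSn; lia.
have hstep k d : k + d <= n -> gdist (rho (h k) o) (rho (h (k + d)) o) <= e * d.
  elim: d => [|d IH] kd; first by rewrite addn0 gdistxx.
  apply: leq_trans (gdist_triangle (rho (h (k + d)) o) _ _) _.
  rewrite mulnSr leq_add ?IH//; first lia.
  rewrite addnS -(gdist_act rho (h (k + d))^-1%g) -!actM mulVg act1.
  by apply: eP; apply: hE; lia.
have zstep m : gdist (z m) (z m.+1) <= e * tau.
  have [/andP[t1 t2] t3] := tS m.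
  have := @hstep (t m) (t m.+1 - t m); rewrite subnKC// => /(_ t2) H.
  by apply: leq_trans H _; rewrite leq_mul2l t3 orbT.
have ab' : (a <= b)%R by lia.
have clamp_le x y B' : (`|x - y| <= B')%N -> (clamp a b y - clamp a b x <= B'%:Z)%R.
  by have := clampP x ab'; have := clampP y ab'; lia.
have far_step m : m < M -> ~ near m -> (q m.+1 - q m <= B1%:Z)%R.
  move=> _ /negP; rewrite -ltnNge => far; apply: clamp_le.
  have [|/(leq_trans far)] := pr_far (z m) (z m.+1); first by rewrite /B1; lia.
  by have := zstep m; rewrite /r; lia.
have zlip m : `|pr (z m) - pr (z m.+1)| <= B2.
  by apply: leq_trans (pr_lip _ _) _; rewrite leq_mul2l ltnS zstep orbT.
have any_step m : m < M -> (q m.+1 - q m <= B2%:Z)%R by move=> _; apply: clamp_le.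
have zfar m d : `|pr (z m) - pr (z (m + d))| <= d * B2.
  elim: d => [|d IH]; first by rewrite addn0; lia.
  by have := zlip (m + d); rewrite addnS mulSn; lia.
have pr_end k x : V ((expgz g x)^-1 * h k)%g -> `|pr (rho (h k) o) - x| <= 2 * A * c.
  move=> /cP; rewrite -(gdist_act rho (expgz g x)) -actM mulgA mulgV mul1g -/(f x) => kc.
  apply: leq_trans (f_lower _ _) _; rewrite -/(f _) -/(f x) mulnAC [2 * c * _]mulnC.
  rewrite leq_mul2l; apply/orP; right; rewrite [f _]/f -/(f _).
  have := gdist_triangle (rho (h k) o) (f (pr (rho (h k) o))) (f x).
  have := prmin (rho (h k) o) x.
  by rewrite (gdist_sym (f (pr _)) (rho _ _)) (gdist_sym (f x)) in kc *; lia.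
apply: contrapT => no.
(* A violation would supply [u], [w] and [k] as in [U0], hence a meeting point excluded by [no]. *)
have near_near m m' : m < m' -> m' <= M -> m' - m <= C3 -> near m -> near m' ->
    (q m' - q m <= K%:Z)%R.
  move=> mm' m'M mC nm nm'; rewrite leNgt; apply/negP => Kq.
  have pT : `|pr (z m') - pr (z m)| <= T.
    have := zfar m (m' - m); rewrite (subnKC (ltnW mm')) distnC => H.
    by apply: leq_trans H _; rewrite leq_mul2r mC orbT.
  have Kp : (K < `|pr (z m') - pr (z m)|)%N.
    by rewrite ltnNge distnC; apply/negP => /clamp_le; rewrite -/(q m') -/(q m); lia.
  (* Since [q m < q m'], clamping can only raise [pr (z m)] to [a], by less than the gap to
     [pr (z m')]. *)
  have pq : `|pr (z m) - q m| <= T.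
    move: pT Kq; rewrite /q; have := clampP (pr (z m)) ab'.
    by have := clampP (pr (z m')) ab'; lia.
  apply: no; exists (t m), (q m); split; [exact: geq_minr|by have := clampP (pr (z m)) ab'; rewrite /q; lia|].
  exists (pr (z m) - q m)%R => //=.
  exists ((expgz g (pr (z m)))^-1 * h (t m))%g; last first.
    by rewrite -!expgzN mulgA -expgzD; congr (expgz g _ * _)%g; lia.
  have mt : m * tau <= m' * tau by rewrite leq_mul2r (ltnW mm') orbT.
  have mCt : (m' - m) * tau <= C3 * tau by rewrite leq_mul2r mC orbT.
  have tt : t m <= t m' by rewrite /t; lia.
  exists ((h (t m))^-1 * h (t m'))%g.
    have := @iter_prod_steps _ _ h n (t m) (t m' - t m) (C3 * tau) hE.
    rewrite subnKC//; apply; first exact: geq_minr.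
    by move: mCt; rewrite mulnBl /t; lia.
  exists (pr (z m') - pr (z m))%R => //=; split; first by [].
  split.
    by rewrite -(gdist_act rho (expgz g (pr (z m)))) -actM mulgA mulgV mul1g gdist_sym.
  rewrite -(gdist_act rho (expgz g (pr (z m)))) -!actM -expgzD subrKC.
  by rewrite -?mulgA !mulVKg gdist_sym.
have C30 : 0 < C3 by [].
have KB : K + B2 <= C3 * B1 by rewrite /B1 mulnS /C3; lia.
have := mean_speed far_step any_step near_near C30 KB.
have q0 : (q 0 <= a + (2 * A * c)%:Z)%R.
  move: (pr_end 0 i Vi); rewrite /q /z (_ : t 0 = 0) ?/t ?mul0n ?min0n//.
  by have := clampP (pr (rho (h 0) o)) ab'; lia.
have qM : (b <= q M + (2 * A * c)%:Z)%R.
  by move: (pr_end n j Vj); rewrite /q /z tM; have := clampP (pr (rho (h n) o)) ab'; lia.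
have nt : ((4 * B1 * (n %/ tau))%:Z <= b - a)%R.
  have : n %/ tau * tau <= n by exact: leq_trunc_div.
  have : 4 * B1 * (n %/ tau) * C.+1 <= n.
    by apply: leq_trans (leq_trunc_div n tau); rewrite mulnC mulnCA mulnA mulnC.
  set N := 4 * B1 * _; set d := `|(b - a)%R| => NC.
  have : N * C.+1 <= d * C.+1 by rewrite (leq_trans NC)// mulnC; nia.
  by rewrite leq_mul2r /= /d; lia.
have split_MC x y w : 2 * y * (x.+1 + w) = 2 * (y * x) + 2 * y * (1 + w) by nia.
rewrite split_MC.
by move=> mean; apply: (slow_drift_absurd q0 qM nt mean ab).
Qed.

(** * The Morse property *)

Section CayleyGraphs.
Variables (G : groupType) (S : generating_set G).
Implicit Types (x y z : cayley S).

Fact left_mul1 x : (1 * x)%g = x. Proof. exact: mul1g. Qed.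
Fact left_mulM (g h : G) x : (g * h * x)%g = (g * (h * x))%g.
Proof. by rewrite mulgA. Qed.
Fact left_mul_adj (g : G) x y : adj (g * x : cayley S)%g (g * y : cayley S)%g = adj x y.
Proof.
rewrite /adj /= /cayley_adj !invgM !mulgA.
rewrite -[(x^-1 * g^-1 * g)%g]mulgA -[(y^-1 * g^-1 * g)%g]mulgA mulVg !mulg1.
by rewrite (inj_eq (mulgI g)).
Qed.
Definition left_mul : graph_action G (cayley S) :=
  @GraphAction G (cayley S) (fun g x => (g * x)%g) left_mul1 left_mulM left_mul_adj.

Lemma gdist_mul (g : G) x y : gdist (g * x : cayley S)%g (g * y : cayley S)%g = gdist x y.
Proof. exact: (gdist_act left_mul g x y). Qed.

Lemma gdist_div x y : gdist (1%g : cayley S) (x^-1 * y)%g = gdist x y.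
Proof. by rewrite -(gdist_mul x) mulg1 mulVKg. Qed.

Definition steps : set G := gens S `|` [set g^-1%g | g in gens S].

Lemma finite_steps : finite_set steps.
Proof.
rewrite finite_setU; split; first exact: gens_finite.
exact/finite_image/gens_finite.
Qed.

Lemma adj_steps x y : adj x y -> steps (x^-1 * y)%g.
Proof.
move=> /andP[_ /asboolP[]]; first by left.
by right; exists (y^-1 * x)%g => //; rewrite invgM invgK.
Qed.

Lemma cayley_walk x y : exists h : nat -> cayley S,
  [/\ h 0 = x, h (gdist x y) = y,
      forall k, k < gdist x y -> steps ((h k)^-1 * h k.+1)%g
    & forall k, k <= gdist x y -> gdist x (h k) <= k].
Proof.
have [p [xp py sp]] := gdistP x y; exists (nth y (x :: p)); split=> //.
- by rewrite -sp nth_last.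
- by move=> k; rewrite -sp => kp; apply: adj_steps; move/pathP: xp; apply.
- move=> k; rewrite -sp => kp; apply: gdist_min; exists (take k p); split.
  + by move: xp; rewrite -{1}(cat_take_drop k p) cat_path => /andP[].
  + by rewrite (last_nth y) size_takel// -[x :: take k p]/(take k.+1 (x :: p)) nth_take.
  + by rewrite size_takel.
Qed.

Lemma finite_ball n : finite_set [set h : G | gdist (1%g : cayley S) h <= n].
Proof.
apply: (@sub_finite_set _ _ (iter_prod steps n)); last exact/finite_iter_prod/finite_steps.
move=> y /= yn; have [h [h0 hy hs _]] := cayley_walk 1%g y.
have := @iter_prod_steps _ _ h _ 0 (gdist (1%g : cayley S) y) n hs (leqnn _) yn.
by rewrite add0n hy h0 invg1 mul1g.
Qed.

Lemma orbit_lipschitz (Gr : connected_graph) (rho : graph_action G Gr) (o : Gr) :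
  exists e, forall x y, gdist (rho x o) (rho y o) <= e * gdist x y.
Proof.
have [e eP] := finite_set_bounded (fun s => gdist o (rho s o)) finite_steps.
exists e => x y; have [h [h0 hy hs _]] := cayley_walk x y.
rewrite -{1}h0 -{1}hy; elim: (gdist x y) hs => [|n IH] hs; first by rewrite gdistxx.
apply: leq_trans (gdist_triangle (rho (h n) o) _ _) _.
rewrite mulnSr leq_add ?IH//; first by move=> k kn; apply: hs; lia.
by rewrite -(gdist_act rho (h n)^-1%g) -!actM mulVg act1; apply: eP; apply: hs.
Qed.

Lemma expgz_lipschitz (g : G) (i j : int) :
  gdist (expgz g i : cayley S) (expgz g j) <= gdist (1%g : cayley S) g * `|i - j|%N.
Proof.
wlog ij : i j / (i <= j)%R.
  move=> H; have [/H//|ji] := boolP (i <= j)%R.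
  by rewrite gdist_sym distnC; apply: H; lia.
have [n ->] : exists n : nat, (j = i + n%:Z)%R by exists `|j - i|%N; lia.
have -> : absz (i - (i + n%:Z))%R = n by lia.
elim: n => [|n IH]; first by rewrite addr0 gdistxx.
apply: leq_trans (gdist_triangle (expgz g (i + n%:Z)%R : cayley S) _ _) _.
rewrite mulnSr leq_add// (_ : (i + n.+1%:Z = i + n%:Z + 1)%R); last lia.
by rewrite expgzSr -{1}[expgz g (i + n%:Z)%R]mulg1 gdist_mul.
Qed.

End CayleyGraphs.

Section Morse.
Variables (R : realType) (G : groupType) (Gr : connected_graph).
Variables (tight : set (seq Gr)) (rho : graph_action G Gr) (g : G).
Hypothesis bow : bowditch_graph R tight.
Hypothesis T1 : tight_T1 tight rho.
Hypothesis acy : acylindrical rho.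
Hypothesis lox : loxodromic R rho g.
Variable S : generating_set G.

(** The orbit map is Lipschitz, so the lower bound in the graph lifts to the Cayley graph. *)
Lemma expgz_lower : exists A, forall i j : int,
  `|i - j|%N <= A * gdist (expgz g i : cayley S) (expgz g j).
Proof.
have [ o [A lowerA]] := loxodromic_lower lox.
have [e eP] := orbit_lipschitz S rho o.
exists (A * e) => i j; apply: leq_trans (lowerA i j) _.
by rewrite -mulnA leq_mul2l eP orbT.
Qed.

(** Consider the excursion around [k] between consecutive close times [k1], [k2]. Its length is
    linear in [|i - j|], so for large [|i - j|] [short_path_meets_axis] yields a close time inside
    it. Hence [|i - j|], and with it the excursion, is bounded. *)
Lemma discrete_morse (L C : nat) : exists M, forall (h : nat -> cayley S) N,
  (forall k, k < N -> gdist (h k) (h k.+1) <= L) ->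
  (forall k k', k <= k' <= N -> k' - k <= L * gdist (h k) (h k') + C) ->
  (exists i, h 0 = expgz g i) -> (exists j, h N = expgz g j) ->
  forall k, k <= N -> exists l, gdist (h k) (expgz g l) <= M.
Proof.
pose A := gdist (1%g : cayley S) g.
have [U finU UP] :=
  short_path_meets_axis bow T1 acy lox (L * A).+1 (finite_ball S L).
have [c cP] := finite_set_bounded (fun u => gdist (1%g : cayley S) u) finU.
have [n0 n0P] := UP _ (finite_ball S (c + L)).
(* [n1] is the additive part of the length bound, absorbed once [|i - j|] exceeds it; [n2] is the
   bound when [|i - j| <= n0 + n1]. *)
pose n1 := L * (2 * (c + L)) + C.
pose n2 := L * (2 * (c + L) + A * (n0 + n1)) + C.
exists (L * (n2 + 2) + c) => h N hL hqg [i0 h0] [j0 hN] k kN.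
(* Adding [1] makes the ends of [h], which lie on the axis, close. *)
pose close m := exists l, (U `|` [set 1%g]) ((expgz g l)^-1 * h m)%g.
have closeP m l : (U `|` [set 1%g]) ((expgz g l)^-1 * h m)%g ->
    gdist (h m) (expgz g l : cayley S) <= c.
  by rewrite gdist_sym -gdist_div; case=> [/cP//|->]; rewrite gdistxx.
have [[l kl]|nk] := pselect (close k); first by exists l; have := closeP _ _ kl; lia.
have ex1 : exists m, (m <= k) && `[< close m >].
  by exists 0; apply/asboolP; exists i0; right; rewrite h0 mulVg.
have ex2 : exists m, (k <= m <= N) && `[< close m >].
  by exists N; rewrite kN leqnn; apply/asboolP; exists j0; right; rewrite hN mulVg.
have bd1 m : (m <= k) && `[< close m >] -> m <= k by case/andP.
case: (ex_maxnP ex1 bd1) => k1 /andP[k1k /asboolP[i ki]] max1.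
case: (ex_minnP ex2) => k2 /andP[/andP[kk2 k2N] /asboolP[j kj]] min2.
have k1k' : k1 < k.
  by rewrite ltn_neqAle k1k andbT; apply: contra_notN nk => /eqP <-; exists i.
have kk2' : k < k2.
  by rewrite ltn_neqAle kk2 andbT; apply: contra_notN nk => /eqP ->; exists j.
have far m : k1 < m < k2 -> ~ close m.
  move=> mm cm; have [mk|km] := leqP m k.
    by have := max1 m; rewrite mk => /(_ (asboolT cm)); lia.
  by have := min2 m; rewrite (ltnW km) (_ : m <= N) ?(asboolT cm)//=; lia.
(* The close ends are dropped; the remaining path starts and ends within [c + L] of the axis. *)
pose n := k2 - k1 - 2.
have di : gdist (expgz g i : cayley S) (h k1.+1) <= c + L.
  have := gdist_triangle (h k1) (expgz g i : cayley S) (h k1.+1).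
  by have := closeP _ _ ki; have := hL k1; rewrite (gdist_sym (expgz g i : cayley S) (h k1)); lia.
have dj : gdist (expgz g j : cayley S) (h k2.-1) <= c + L.
  have := gdist_triangle (h k2) (expgz g j : cayley S) (h k2.-1).
  have := closeP _ _ kj; have := hL k2.-1; rewrite prednK; last lia.
  by rewrite (gdist_sym (expgz g j : cayley S) (h k2)) (gdist_sym (h k2) (h k2.-1)); lia.
have dij := expgz_lipschitz S g i j; rewrite -/A in dij.
have nL : n <= L * (2 * (c + L) + A * `|i - j|%N) + C.
  have := @hqg k1.+1 k2.-1 ltac:(lia).
  rewrite (_ : k2.-1 - k1.+1 = n); last by rewrite /n; lia.
  move=> nn; apply: leq_trans nn _; rewrite leq_add2r leq_mul2l; apply/orP; right.
  have := gdist_triangle (expgz g i : cayley S) (h k1.+1) (h k2.-1).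
  have := gdist_triangle (expgz g j : cayley S) (expgz g i : cayley S) (h k2.-1).
  by rewrite (gdist_sym (h k1.+1) (expgz g i : cayley S)); lia.
have ij_small : (`|i - j| <= n0 + n1)%N.
  rewrite leqNgt; apply/negP => ij_big.
  have nC : n <= (L * A).+1 * `|i - j|%N.
    by apply: leq_trans nL _; rewrite /n1 in ij_big; rewrite mulnDr mulSn mulnA; lia.
  have [ij|ji] := boolP (i <= j)%R.
    have [|||||||m [l [mn _ Um]]] := n0P (fun m => h (k1.+1 + m)) n i j i j.
    - by move=> m mn /=; rewrite gdist_div addnS; apply: hL; rewrite /n in mn; lia.
    - by rewrite /= gdist_div addn0.
    - by rewrite /= gdist_div (_ : k1.+1 + n = k2.-1)// /n; lia.
    - by lia.
    - by [].
    - by [].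
    - by lia.
    by apply: (far (k1.+1 + m)); [rewrite /n in mn; lia|exists l; left].
  (* For [j < i] the excursion is read backwards. *)
  have [|||||||m [l [mn _ Um]]] := n0P (fun m => h (k2.-1 - m)) n j i j i.
  - move=> m mn /=; rewrite gdist_div gdist_sym subnS.
    by have := hL (k2.-1 - m).-1; rewrite prednK; [apply|]; rewrite /n in mn; lia.
  - by rewrite /= gdist_div subn0.
  - by rewrite /= gdist_div (_ : k2.-1 - n = k1.+1)// /n; lia.
  - by rewrite distnC in nC; lia.
  - by [].
  - by [].
  - by lia.
  by apply: (far (k2.-1 - m)); [rewrite /n in mn; lia|exists l; left].
have n_small : n <= n2.
  by apply: leq_trans nL _; rewrite leq_add2r leq_mul2l leq_add2l leq_mul2l ij_small !orbT.
exists i; apply: leq_trans (gdist_triangle (h k1) _ _) _.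
apply: leq_add; last exact: closeP.
apply: (@leq_trans (L * (k - k1))); last by rewrite leq_mul2l /n in n_small *; lia.
rewrite gdist_sym; have : k1 + (k - k1) <= N by lia.
rewrite -{2}(subnKC k1k); elim: (k - k1) => [|d IH] kd; first by rewrite addn0 gdistxx.
apply: leq_trans (gdist_triangle (h (k1 + d)) _ _) _.
by rewrite mulnSr addnS leq_add ?IH ?hL//; lia.
Qed.

Lemma mdist_cayley (x y : gmetric R (cayley S)) :
  mdist x y = (gdist (x : cayley S) y)%:R%R.
Proof. by []. Qed.

Lemma normr_int_sub (m n : int) : (`|m%:~R - n%:~R| = `|m - n|%N%:R :> R)%R.
Proof. by rewrite -rmorphB -intr_norm -abszE. Qed.

(** A continuous quasi-geodesic is sampled at unit times and at its end [b], reducing to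
    [discrete_morse]. *)
Lemma loxodromic_morse : @morse R (gmetric R (cayley S)) (fun n => expgz g n).
Proof.
split.
  have [A lowerA] := expgz_lower.
  pose B := (gdist (1%g : cayley S) g + A).+1.
  exists B%:R%R, 0%R; split=> //; first by rewrite ler1n.
  move=> s t _ _; rewrite normr_int_sub subr0 addr0 ler_pdivrMr ?ltr0n//.
  rewrite -!natrM !ler_nat; apply/andP; split.
    by apply: leq_trans (lowerA s t) _; rewrite mulnC leq_mul2l /B; lia.
  by apply: leq_trans (expgz_lipschitz S g s t) _; rewrite leq_mul2r /B; lia.
move=> L C L1 C0; have L0 : (0 < L)%R by apply: lt_le_trans L1.
(* The [1] in [Y] pays for the last interval, which may be shorter than a unit. *)
pose X := Num.bound (L + C)%R; pose Y := Num.bound (L * C + 1)%R.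
have XP : (L + C <= X%:R)%R by apply/ltW/archi_boundP; rewrite addr_ge0// ltW.
have YP : (L * C + 1 <= Y%:R)%R.
  by apply/ltW/archi_boundP; rewrite addr_ge0// mulr_ge0// ltW.
have [M MP] := discrete_morse X Y.
exists (X + M)%:R%R => a b p ab qg [i _ pa] [j _ pb] t /[!in_itv]/= /andP[ta tb].
pose N := (Num.truncn (b - a)).+1.
have ba0 : (0 <= b - a)%R by rewrite subr_ge0.
have /andP[Nl Nu] := truncn_itv ba0.
pose tau (k : nat) : R := Num.min (a + k%:R)%R b.
have tauI k : `[a, b]%classic (tau k).
  by rewrite /= in_itv /= le_min ge_min lexx ab lerDl ler0n orbT.
have hqg k k' : (mdist (p (tau k)) (p (tau k')) <= L * `|tau k - tau k'| + C)%R.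
  by have /andP[] := qg _ _ (tauI k) (tauI k').
have tau_step k : (`|tau k - tau k.+1| <= 1)%R.
  rewrite /tau -natr1; case: (leP (a + k%:R)%R b) => h1;
    case: (leP (a + (k%:R + 1))%R b) => h2; rewrite ler_norml; lra.
have [k [kN kt]] : exists k, k <= N /\ (`|t - tau k| <= 1)%R.
  exists (Num.truncn (t - a)); split.
    by apply: leqW; apply: le_truncn; rewrite lerD2r.
  have ta0 : (0 <= t - a)%R by rewrite subr_ge0.
  have /andP[] := truncn_itv ta0.
  set k := Num.truncn _; rewrite -natr1 /tau => h1 h2.
  by rewrite min_l ?ler_norml; lra.
have [||||l kl] := MP (fun k => p (tau k)) N _ _ _ _ k kN.
- move=> m mN; rewrite -(ler_nat R); apply: le_trans (hqg m m.+1) _.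
  by apply: le_trans XP; rewrite lerD2r ler_piMr// ltW.
- move=> m m' /andP[mm' m'N].
  have /andP[+ _] := qg _ _ (tauI m) (tauI m').
  rewrite lerBlDr ler_pdivrMr// distrC => H.
  rewrite -(ler_nat R) natrD natrM natrB//.
  have tt : (m'%:R - m%:R - 1 <= `|tau m' - tau m|)%R.
    apply: le_trans (ler_norm _).
    have m'N' : (m'%:R <= (Num.truncn (b - a)).+1%:R :> R)%R by rewrite ler_nat.
    have mm'R : (m%:R <= m'%:R :> R)%R by rewrite ler_nat.
    rewrite /tau -natr1 in m'N' *.
    by case: (leP (a + m%:R)%R b) => h1; case: (leP (a + m'%:R)%R b) => h2; lra.
  have : (L * (gdist (p (tau m) : cayley S) (p (tau m')))%:R
          <= X%:R * (gdist (p (tau m) : cayley S) (p (tau m')))%:R)%R.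
    by rewrite ler_wpM2r//; lra.
  move: H; rewrite mdist_cayley; nra.
- by exists i; rewrite pa /tau addr0 min_l.
- by exists j; rewrite pb /tau min_r// -lerBlDl ltW.
exists l; apply: le_trans (metric_triangle (p t) (p (tau k)) _) _.
rewrite natrD; apply: lerD; last by rewrite mdist_cayley ler_nat.
have tI : `[a, b]%classic t by rewrite /= in_itv /= ta tb.
have /andP[_ H] := qg _ _ tI (tauI k).
by apply: le_trans H _; apply: le_trans XP; rewrite lerD2r ler_piMr// ltW.
Qed.

End Morse.

(** * Cut points of asymptotic cones *)

Section Chains.
Variables (R : realType) (T : metricType R) (p : T).
Local Open Scope ring_scope.

(** A hop is short relative to the distance to [p], so that a geodesic lifting it stays away from
    [p]. *)
Definition short_hop : rel T := fun x y => 2 * mdist x y < mdist x p.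

(** The points reachable from [x] by short hops form an open and closed subset of the complement of
    [p]. *)
Lemma connected_chain (x y : T) : connected (~` [set p]) -> x != p -> y != p ->
  exists2 s, path short_hop x s & last x s = y.
Proof.
move=> conn xp yp.
pose B : set T := [set z | exists2 s, path short_hop x s & last x s = z].
have hop_neq u v : u != p -> short_hop u v -> v != p.
  rewrite -!mdist_gt0 /short_hop => up uv; have := metric_triangle u v p.
  have := mdist_ge0 u v; lra.
have Bp : B `<=` ~` [set p].
  move=> z [s]; elim: s x xp {B} => [|v s IH] u up /=.
    by move=> _ <- /= up'; rewrite up' eqxx in up.
  by move=> /andP[uv vs] sz; apply: (IH v) => //; apply: hop_neq uv.
have Bhop u v : B u -> short_hop u v -> B v.
  move=> [s xs su] uv; exists (rcons s v); last by rewrite last_rcons.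
  by rewrite rcons_path xs su.
suff BE : B = ~` [set p] by have : B y by rewrite BE; apply/eqP.
apply: conn; first by exists x, [::].
- exists B; last by apply/esym/setIidr.
  rewrite openE => u Bu; rewrite /interior -nbhs_ballE.
  have up : 0 < mdist u p by rewrite mdist_gt0; apply/eqP; exact: Bp.
  exists (mdist u p / 2); first by rewrite /= divr_gt0.
  move=> v; rewrite ballEmdist /= => uv; apply: Bhop Bu _.
  by rewrite /short_hop; lra.
- exists (closure B); first exact: closed_closure.
  apply/seteqP; split=> [u Bu|u [/= /eqP up Bu]].
    by split; [exact: Bp|exact: subset_closure].
  (* A third suffices: [v] is then more than twice as far from [p] as from [u]. *)
  have up' : 0 < mdist u p / 3 by rewrite divr_gt0 ?mdist_gt0.
  have [v [Bv]] := Bu _ (nbhsx_ballx u _ up').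
  rewrite ballEmdist /= => uv; apply: Bhop Bv _; rewrite /short_hop metric_sym.
  have := metric_triangle u v p; lra.
Qed.

End Chains.

Section AsymptoticCone.
Variables (R : realType) (X : metricType R) (D : cone_data X).
Local Open Scope ring_scope.
Local Notation omega := (cone_filter D).
Implicit Types u v : cone_seq D.

Lemma ulim_dist_near u v (e : R) : 0 < e -> \forall n \near omega,
  (ulim_dist u v - e) * cone_scale D n <= mdist (val u n) (val v n) <=
  (ulim_dist u v + e) * cone_scale D n.
Proof.
move=> e0; have /cvgrPdist_lt/(_ e e0) H := @ulim_dist_cvg _ _ D u v.
near=> n.
have s0 : 0 < cone_scale D n by near: n; exact: scale_gt0.
have : `|ulim_dist u v - rescaled D (val u) (val v) n| < e by near: n.
rewrite ltr_norml /rescaled => /andP[h1 h2].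
have -> : mdist (val u n) (val v n) =
    mdist (val u n) (val v n) / cone_scale D n * cone_scale D n.
  by rewrite divfK ?gt_eqF.
by rewrite !ler_pM2r//; apply/andP; split; lra.
Unshelve. all: by end_near. Qed.

Definition cone_class u : asymptotic_cone D := (\pi_(asymptotic_cone D) u)%qT.
Definition cone_repr (P : asymptotic_cone D) : cone_seq D := generic_quotient.repr P.

Lemma scale_gt (K : R) : \forall n \near omega, K < cone_scale D n.
Proof. exact: (cvgry_gt (@cone_scale_cvg _ _ D) K). Qed.

Lemma ulim_dist_repr u : ulim_dist u (cone_repr (cone_class u)) = 0.
Proof.
have e : (\pi_(asymptotic_cone D) u = \pi_(asymptotic_cone D)
  (generic_quotient.repr (\pi_(asymptotic_cone D) u)))%qT.
  by rewrite generic_quotient.reprK.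
by move/eqquotP: e => /eqP.
Qed.

Lemma mdist_repr P u : mdist P (cone_class u) = ulim_dist (cone_repr P) u.
Proof.
rewrite -[LHS]/(ulim_dist (cone_repr P) (cone_repr (cone_class u))).
have := ulim_dist_triangle u (cone_repr P) (cone_repr (cone_class u)).
have := ulim_dist_triangle (cone_repr (cone_class u)) (cone_repr P) u.
by rewrite (ulim_dist_sym (cone_repr (cone_class u)) u) ulim_dist_repr; lra.
Qed.

Lemma mdist_class u v : mdist (cone_class u) (cone_class v) = ulim_dist u v.
Proof.
rewrite mdist_repr; have := ulim_dist_repr u.
have := ulim_dist_triangle u (cone_repr (cone_class u)) v.
have := ulim_dist_triangle (cone_repr (cone_class u)) u v.
rewrite (ulim_dist_sym (cone_repr (cone_class u)) u); lra.
Qed.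

End AsymptoticCone.

Section CutPoints.
Variables (R : realType) (G : groupType) (S : generating_set G).
Variable D : cone_data (gmetric R (cayley S)).
Local Open Scope ring_scope.
Local Notation omega := (cone_filter D).
Local Notation base := (cone_base D).
Local Notation scale := (cone_scale D).
Implicit Types u v w : cone_seq D.

Let gd (x y : G) : nat := gdist (x : cayley S) (y : cayley S).

(* Ultralimits of paths of linear length that avoid a ball of linear radius about the base point. *)
Definition linked u v := exists (C e : R), 0 < e /\ \forall n \near omega,
  exists (h : nat -> G) (N : nat), [/\ h 0%N = val u n, h N = val v n,
    forall k, (k < N)%N -> steps S ((h k)^-1 * h k.+1)%g,
    N%:R <= C * scale n & forall k, (k <= N)%N -> e * scale n <= (gd (base n) (h k))%:R].

Lemma linked_trans v u w : linked u v -> linked v w -> linked u w.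
Proof.
move=> [C1 [e1 [e10 H1]]] [C2 [e2 [e20 H2]]].
exists (C1 + C2), (Num.min e1 e2); split; first by rewrite lt_min e10.
apply: filterS3 (scale_gt0 D) H1 H2 => n s0.
move=> [h1 [N1 [h10 h1N h1S N1C h1e]]] [h2 [N2 [h20 h2N h2S N2C h2e]]].
exists (fun k => if (k <= N1)%N then h1 k else h2 (k - N1)%N), (N1 + N2)%N; split.
- by rewrite leq0n.
- case: leqP => [le|_]; last by rewrite addKn.
  have N20 : N2 = 0%N by lia.
  by rewrite -h2N N20 addn0 h1N -h20.
- move=> k kN; case: (ltngtP k N1) => kN1; last first.
  + by rewrite kN1 subSnn h1N -h20; apply: h2S; lia.
  + by rewrite subSn; [apply: h2S; lia|lia].
  + by apply: h1S.
- by rewrite natrD mulrDl lerD.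
- move=> k kN; case: leqP => kN1.
    by apply: le_trans (h1e k kN1); rewrite ler_pM2r// ge_min lexx.
  apply: le_trans (h2e (k - N1)%N _); last by lia.
  by rewrite ler_pM2r// ge_min lexx orbT.
Qed.

Fact base_admissible : `[< admissible D base >].
Proof.
apply/asboolP; exists 0; apply: nearW => n.
by rewrite /rescaled mdistxx mul0r.
Qed.

Definition base_seq : cone_seq D := exist _ base base_admissible.

(** Lift by geodesics of the Cayley graph: they have length about [d * scale n] and start about
    [r * scale n] from the base point; [e] absorbs the errors. *)
Lemma linked_hop u v : 2 * ulim_dist u v < ulim_dist u base_seq -> linked u v.
Proof.
set d := ulim_dist u v; set r := ulim_dist u base_seq => dr.
have d0 : 0 <= d by exact: ulim_dist_ge0.
pose e := (r - 2 * d) / 8; have e0 : 0 < e by rewrite divr_gt0// subr_gt0.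
exists (d + e), e; split=> //.
apply: filterS3 (scale_gt0 D) (ulim_dist_near u v e0) (ulim_dist_near u base_seq e0).
move=> n s0 /andP[_ uv] /andP[ub _].
have [h [h0 hN hS hd]] := cayley_walk (val u n : cayley S) (val v n).
exists h, (gd (val u n) (val v n)); split=> //.
move=> k kN; have hk := hd k kN.
have tri : (gd (val u n) (base n) <= k + gd (base n) (h k))%N.
  apply: leq_trans (gdist_triangle (h k : cayley S) _ _) _.
  by rewrite /gd (gdist_sym (base n : cayley S)) leq_add2r.
move: tri; rewrite -(ler_nat R) natrD => tri.
have : (r - e) * scale n <= (gd (val u n) (base n))%:R by [].
have : k%:R <= (d + e) * scale n by apply: le_trans uv; rewrite mdist_cayley ler_nat.
have : r = 8 * e + 2 * d by rewrite /e; lra.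
nra.
Qed.

(** Chains lift hop by hop; hops of length zero pass between a sequence and the representative of
    its class. *)
Lemma linked_of_connected u v : connected (~` [set cone_class base_seq]) ->
  0 < ulim_dist u base_seq -> 0 < ulim_dist v base_seq -> linked u v.
Proof.
set P := cone_class base_seq => conn u0 v0.
have class_neq w : 0 < ulim_dist w base_seq -> cone_class w != P.
  by rewrite -mdist_gt0 mdist_class.
have [s us sv] := connected_chain conn (class_neq _ u0) (class_neq _ v0).
apply: (@linked_trans (cone_repr (cone_class u))).
  by apply: linked_hop; rewrite ulim_dist_repr mulr0.
apply: (@linked_trans (cone_repr (cone_class v))); last first.
  apply: linked_hop; rewrite ulim_dist_sym ulim_dist_repr mulr0.
  by rewrite -mdist_repr mdist_class.
rewrite -sv; have := class_neq _ u0; move: {sv} (cone_class u) us => Q.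
elim: s Q => [|Q' s IH] Q /=.
  by move=> _ QP; apply: linked_hop; rewrite ulim_distxx mulr0 -mdist_repr mdist_gt0.
move=> /andP[QQ' Q's] QP; apply: (@linked_trans (cone_repr Q')).
  by apply: linked_hop; rewrite -(mdist_repr Q base_seq).
apply: IH => //; move: QP; rewrite -!mdist_gt0 => QP.
have := metric_triangle Q Q' P; move: QQ'; rewrite /short_hop.
have := mdist_ge0 Q Q'; lra.
Qed.

Section Axis.
Variables (Gr : connected_graph) (tight : set (seq Gr)) (rho : graph_action G Gr) (g : G).
Hypothesis bow : bowditch_graph R tight.
Hypothesis T1 : tight_T1 tight rho.
Hypothesis acy : acylindrical rho.
Hypothesis lox : loxodromic R rho g.

(** For [sg] equal to [1] or [-1], these are points on either side of the base point on a translate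
    of the axis. *)
Definition axis_seq (sg : int) (n : nat) : gmetric R (cayley S) :=
  (base n * expgz g (sg * (Num.truncn (scale n))%:Z))%g.

Lemma mdist_base_axis sg n :
  mdist (base n) (axis_seq sg n) =
  (gd 1%g (expgz g (sg * (Num.truncn (scale n))%:Z)%R))%:R.
Proof. by rewrite mdist_cayley -gdist_div /axis_seq mulKg. Qed.

Lemma axis_admissible sg : `[< admissible D (axis_seq sg) >].
Proof.
apply/asboolP; pose A := gd 1%g g; exists (A * `|sg|)%:R.
apply: filterS (scale_gt0 D) => n s0; rewrite /rescaled mdist_base_axis ler_pdivrMr//.
apply: (@le_trans _ _ (A * `|sg| * Num.truncn (scale n))%:R).
  rewrite ler_nat; apply: leq_trans (expgz_lipschitz S g 0 _) _.
  by rewrite -mulnA leq_mul2l; apply/orP; right; rewrite sub0r abszN abszM.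
by rewrite natrM ler_wpM2l// truncn_le ltW.
Qed.

Definition axis_point sg : cone_seq D := exist _ (axis_seq sg) (axis_admissible sg).

(** The lower bound of [expgz_lower] survives rescaling; once the scale exceeds 2, truncation loses
    less than half of it. *)
Lemma axis_point_far sg : `|sg|%N = 1%N -> 0 < ulim_dist (axis_point sg) base_seq.
Proof.
move=> sg1; have [A lowerA] := expgz_lower lox S.
rewrite lt_neqAle ulim_dist_ge0 andbT eq_sym; apply/negP => /eqP d0.
pose e : R := (2 * A.+1%:R)^-1; have e0 : 0 < e by rewrite invr_gt0 mulr_gt0.
have big := scale_gt D 2.
have [n [big_n /andP[_ nd]]] := filter_ex (filterI big (ulim_dist_near (axis_point sg) base_seq e0)).
move: nd; rewrite d0 add0r metric_sym mdist_base_axis.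
set m := Num.truncn _; set d := gd _ _ => nd.
have md : (m <= A * d)%N.
  apply: leq_trans (lowerA 0 (sg * m%:Z)); rewrite sub0r abszN abszM sg1 mul1n.
  exact: leqnn.
have /andP[_ sm] := truncn_itv (ltW (lt_trans (ltr0Sn R 1) big_n)).
have eA : A%:R * e <= 2^-1.
  by rewrite /e ler_pdivrMr ?mulr_gt0// mulrA mulVf// mul1r ler_nat.
have {}md : (m%:R <= A%:R * d%:R :> R) by rewrite -natrM ler_nat.
have Ad : A%:R * d%:R <= A%:R * (e * scale n) by rewrite ler_wpM2l.
have : A%:R * e * scale n <= 2^-1 * scale n by rewrite ler_wpM2r//; lra.
rewrite -/m -natr1 in sm; lra.
Qed.

(** A link would come close to the axis over the short segment [[-q, q]], that is, inside the ball
    it has to avoid. *)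
Lemma axis_not_linked : ~ linked (axis_point (- 1)) (axis_point 1).
Proof.
move=> [C [e [e0 H]]]; pose A := gd 1%g g.
(* With [q = m %/ Q], the part [A * q] is at most a quarter of [e * scale n]; [big2] makes [c] less
   than half of it. *)
pose Q := (Num.bound (4 * A%:R / e)).+1.
have AQ : 4 * A%:R <= e * Q%:R.
  rewrite [e * _]mulrC -ler_pdivrMr//.
  apply: (@le_trans _ _ (Num.bound (4 * A%:R / e))%:R); last by rewrite ler_nat.
  by apply/ltW/archi_boundP; apply: divr_ge0; [rewrite mulr_ge0|exact: ltW].
pose C' := Num.bound (`|C| * Q%:R).
have CQ : `|C| * Q%:R <= C'%:R by apply/ltW/archi_boundP; rewrite mulr_ge0.
have [U finU UP] := short_path_meets_axis bow T1 acy lox C' (finite_steps S).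
have [c cP] := finite_set_bounded (gd 1%g) finU.
(* After translation by the inverse of the base point the path ends exactly on the axis, so the
   singleton of [1] suffices. *)
have [n0 n0P] := UP _ (finite_set1 1%g).
have big1 := scale_gt D ((n0 + 2) * Q)%:R.
have big2 := scale_gt D (2 * c%:R / e).
have [n [s1 [s2 [h [N [h0 hN hS NC he]]]]]] := filter_ex (filterI big1 (filterI big2 H)).
have s0 : 0 < scale n by apply: le_lt_trans s1.
have /andP[] := truncn_itv (ltW s0).
set m := Num.truncn (scale n) => ms sm.
pose q := (m %/ Q)%N.
have qm : (q * Q <= m)%N by exact: leq_trunc_div.
have mq : (m.+1 <= q.+1 * Q)%N by rewrite -ltn_divLR.
have qs : q%:R * Q%:R <= scale n by apply: le_trans ms; rewrite -natrM ler_nat.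
have sq : scale n <= q.+1%:R * Q%:R.
  by apply: le_trans (ltW sm) _; rewrite -natrM ler_nat.
have n0q : (n0 < q)%N.
  have : ((n0 + 2) * Q < q.+1 * Q)%N.
    by rewrite -(ltr_nat R); apply: lt_le_trans s1 _; rewrite natrM.
  by rewrite ltn_mul2r addn2 ltnS => /andP[_ /ltnW].
have Nq : (N <= C' * (2 * q))%N.
  rewrite -(ler_nat R); apply: le_trans NC _.
  apply: (@le_trans _ _ (`|C| * (q.+1%:R * Q%:R))).
    apply: (@le_trans _ _ (`|C| * scale n)); last by rewrite ler_wpM2l.
    by rewrite ler_wpM2r ?ler_norm// ltW.
  rewrite mulrCA mulrC natrM; apply: ler_pM => //.
  by rewrite ler_nat mul2n -addnn -addn1 leq_add2l (leq_ltn_trans _ n0q).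
have qm' : (q <= m)%N by apply: leq_trans qm; rewrite leq_pmulr.
have [|||||||k [l [kN lq Uk]]] :=
  n0P (fun k => (base n)^-1 * h k)%g N (- m%:Z) m%:Z (- q%:Z) q%:Z.
- by move=> k kN /=; rewrite invgM invgK mulgA mulgK; apply: hS.
- by rewrite /= h0 /= /axis_seq -/m mulKg mulN1r mulVg.
- by rewrite /= hN /= /axis_seq -/m mulKg mul1r mulVg.
- by clear - Nq; lia.
- by rewrite lerN2 lez_nat.
- by rewrite lez_nat.
- by clear - n0q; lia.
have := he k kN; rewrite leNgt => /negP; apply.
have hk : (gd (base n) (h k) <= A * q + c)%N.
  rewrite /gd -gdist_div; apply: leq_trans (gdist_triangle (expgz g l : cayley S) _ _) _.
  apply: leq_add; last by rewrite -gdist_div; exact: cP.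
  apply: leq_trans (expgz_lipschitz S g 0 l) _; rewrite leq_mul2l.
  by apply/orP; right; clear - lq; lia.
have ec : 2 * c%:R < e * scale n by rewrite [e * _]mulrC -ltr_pdivrMr.
have Aq : 4 * A%:R * q%:R <= e * scale n.
  apply: (@le_trans _ _ (e * Q%:R * q%:R)); first by rewrite ler_wpM2r.
  by rewrite -mulrA ler_pM2l// mulrC.
have : (gd (base n) (h k))%:R <= A%:R * q%:R + c%:R :> R.
  by rewrite -natrM -natrD ler_nat.
have es : 0 < e * scale n by rewrite mulr_gt0.
clear - ec Aq es; lra.
Qed.

Lemma base_cut_point : cut_point (cone_class base_seq).
Proof.
move=> conn; apply: axis_not_linked.
by apply: linked_of_connected conn _ _; apply: axis_point_far.
Qed.

End Axis.

End CutPoints.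

Theorem theorem4p9 (R : realType) (G : groupType) (S : generating_set G)
    (Gr : connected_graph) (tight : set (seq Gr)) (rho : graph_action G Gr) :
  bowditch_graph R tight ->
  tight_action R S tight rho ->
  acylindrical rho ->
  (forall g : G, loxodromic R rho g -> morse_element R g) /\
  ((exists g : G, loxodromic R rho g) ->
   forall (S' : generating_set G) (D : cone_data (gmetric R (cayley S'))),
     exists p : asymptotic_cone D, cut_point p).
Proof.
move=> bow [T1 _] acy; split=> [g lox S'|[g lox] S' D].
  exact: (loxodromic_morse bow T1 acy lox S').
by exists (cone_class (base_seq D)); exact: (base_cut_point bow T1 acy lox).
Qed.
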